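(* Suppose that for some $0<\beta<1/2$, $\{u_\varepsilon\}\subset\mathcal{A}_\alpha$ satisfies the uniform energy bound $$\tilde E_\varepsilon(u_\varepsilon)\le C_0<\infty.$$ Then $|u_\varepsilon|^2\to1$ in $L^2(0,1)$ (as $\varepsilon\to0$) and there exists a finite set $J'\subset(0,1)$ and a subsequence $\{u_{\varepsilon_\ell}\}$ such that for every compact set $K\subset\subset(0,1)\setminus J'$, there exists an $\varepsilon_0(K)>0$ such that for every $\varepsilon_\ell<\varepsilon_0$ one has $|u_{\varepsilon_\ell}|>0$ on $K$ and there is a lifting whereby $u_{\varepsilon_\ell}=\rho_{\varepsilon_\ell}e^{2\pi iv_{\varepsilon_\ell}/\varepsilon_\ell^\beta}$, with $$v_{\varepsilon_\ell}\to x\quad\text{strongly in }H^1_{loc}((0,1)\setminus J').$$ In addition, we have $$u_\varepsilon\rightharpoonup0\quad\text{weakly in }L^2((0,1);\mathbb{C}),$$ so that the entire sequence converges weakly to $0$.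
   Context: Fix a constant $L>0$ and $\alpha\in[0,2\pi)$. Identify $\mathbb{R}^2$ with $\mathbb{C}$ when convenient. Let $$\mathcal{A}_\alpha=\{u\in H^1((0,1);\mathbb{R}^2): u(0)=1,\ u(1)=e^{i\alpha}\}.$$ For $\varepsilon>0$ and $u=(u_1,u_2)\in\mathcal{A}_\alpha$ set $$\tilde E_\varepsilon(u)=\int_0^1 \frac{\varepsilon}{2}|u'|^2+\frac{1}{4\varepsilon}(|u|^2-1)^2+\frac{L}{2}(u_1u_2'-u_2u_1'-2\pi\varepsilon^{-\beta})^2\,dx.$$ Here $\rho_{\varepsilon_\ell}=|u_{\varepsilon_\ell}|$, $v_{\varepsilon_\ell}$ is real-valued, ''$x$'' denotes the identity function $x\mapsto x$, and $C_0$ is independent of $\varepsilon$. *)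

(* Defs.v *)
From HB Require Import structures.
From mathcomp Require Import all_boot all_order all_algebra.
From mathcomp Require Import all_classical all_reals all_analysis.

Set Implicit Arguments.
Unset Strict Implicit.
Unset Printing Implicit Defensive.

Import Order.TTheory GRing.Theory Num.Theory.
Import numFieldNormedType.Exports.

Local Open Scope classical_set_scope.
Local Open Scope ring_scope.

Section LebesgueSobolev.
Context {R : realType}.
Implicit Types (U D Omega K : set R) (f g phi : R -> R).

Local Notation mu := (@lebesgue_measure R).

(* Functions are total on R; only the values on D matter, and [f \_ D] is the
   extension of the restriction of f to D by zero. *)
Definition L2 D f : Prop := f \_ D \in Lfun mu 2%:E.

Definition L2norm D f : \bar R := ('N[mu]_2%:E[EFin \o (f \_ D)])%E.

Definition cvg_L2 (I : Type) (F : set_system I) D (f : I -> R -> R) g : Prop :=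
  (\forall i \near F, L2 D (f i \- g)) /\
  L2norm D (f i \- g) @[i --> F] --> 0%E.

Definition test_function U phi : Prop :=
  [/\ forall x, derivable phi x 1,
      continuous (derive1 phi),
      compact (closure [set x | phi x != 0]) &
      closure [set x | phi x != 0] `<=` U].

(* Weak derivatives and the norm of H^1 = W^{1,2} follow Brezis, "Functional
   Analysis, Sobolev Spaces and Partial Differential Equations", Chapter 8:
   C^1_c test functions, and the sum of the two L^2 norms. *)
Definition is_weak_derivative U f g : Prop :=
  forall phi, test_function U phi ->
    (\int[mu]_(x in U) (f x * derive1 phi x) =
     - (\int[mu]_(x in U) (g x * phi x)))%R.

Definition H1 U f : Prop :=
  L2 U f /\ exists2 g, L2 U g & is_weak_derivative U f g.

(* For U open and f in H1 U, the weak derivative is unique up to a null subset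
   of U; the value 0 outside H1 U is junk. *)
Definition weak_derivative U f : R -> R :=
  xget (cst 0) [set g | L2 U g /\ is_weak_derivative U f g].

Definition H1norm U f : \bar R :=
  (L2norm U f + L2norm U (weak_derivative U f))%E.

Definition cvg_H1loc (I : Type) (F : set_system I) Omega (f : I -> R -> R) g :
    Prop :=
  forall U, open U -> compact (closure U) -> closure U `<=` Omega ->
    [/\ H1 U g, \forall i \near F, H1 U (f i) &
        H1norm U (f i \- g) @[i --> F] --> 0%E].

End LebesgueSobolev.

(* R^2 and C are both represented by R * R.  The library norm of R * R is the
   sup norm, hence the explicit modulus. *)
Section Plane.
Context {R : realType}.
Implicit Types (D : set R) (w f g psi : R -> R * R).

Local Notation mu := (@lebesgue_measure R).

Definition modulus (z : R * R) : R := Num.sqrt (z.1 ^+ 2 + z.2 ^+ 2).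

(* e^{i t} *)
Definition expi (t : R) : R * R := (cos t, sin t).

Definition fst_part w : R -> R := fun x => (w x).1.
Definition snd_part w : R -> R := fun x => (w x).2.

Definition L2C D f : Prop := L2 D (fst_part f) /\ L2 D (snd_part f).

(* The complex number \int_D f \overline{psi}. *)
Definition inner_L2C D f psi : R * R :=
  ((\int[mu]_(x in D) ((f x).1 * (psi x).1 + (f x).2 * (psi x).2))%R,
   (\int[mu]_(x in D) ((f x).2 * (psi x).1 - (f x).1 * (psi x).2))%R).

Definition weak_cvg_L2C (I : Type) (F : set_system I) D
    (f : I -> R -> R * R) g : Prop :=
  [/\ L2C D g, \forall i \near F, L2C D (f i) &
      forall psi, L2C D psi ->
        inner_L2C D (f i) psi @[i --> F] --> inner_L2C D g psi].

End Plane.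

Section Energy.
Context {R : realType}.

Local Notation mu := (@lebesgue_measure R).

(* The class A_alpha; an element of H^1((0,1)) is taken to be its continuous
   representative on [0,1], which gives the endpoint conditions a meaning. *)
Definition admissible (alpha : R) : set (R -> R * R) :=
  [set u | [/\ H1 `]0, 1[ (fst_part u), H1 `]0, 1[ (snd_part u),
               {within `[0, 1], continuous u},
               u 0 = (1, 0) & u 1 = expi alpha]].

Definition energy (L beta eps : R) (u : R -> R * R) : \bar R :=
  let u1 := fst_part u in
  let u2 := snd_part u in
  let du1 := weak_derivative `]0, 1[ u1 in
  let du2 := weak_derivative `]0, 1[ u2 in
  (\int[mu]_(x in `]0%R, 1%R[)
    (eps / 2 * (du1 x ^+ 2 + du2 x ^+ 2)
     + (4 * eps)^-1 * (modulus (u x) ^+ 2 - 1) ^+ 2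
     + L / 2 * (u1 x * du2 x - u2 x * du1 x
                - 2 * pi * eps `^ (- beta)) ^+ 2)%:E)%E.

End Energy.

(* Main.v *)
Require Import Defs.
From HB Require Import structures.
From mathcomp Require Import all_boot all_order all_algebra.
From mathcomp Require Import all_classical all_reals all_analysis.
From mathcomp Require Import measurable_realfun ring lra.

Import Order.TTheory GRing.Theory Num.Theory.
Import numFieldNormedType.Exports.

Local Open Scope classical_set_scope.
Local Open Scope ring_scope.

Set Implicit Arguments.
Unset Strict Implicit.
Unset Printing Implicit Defensive.

(** The energy controls three quantities on (0, 1): the potential
    [(|u|^2 - 1)^2], with a factor [1 / eps]; the twist [(j - kap)^2], where
    [j = u1 u2' - u2 u1'] and [kap = 2 pi eps^(- beta)]; and, by Young's
    inequality between the gradient term and the potential, the product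
    [||u|^2 - 1| |u'|], with no factor at all ([young_density]).  The first one
    gives the strong convergence of [|u|^2] to 1.

    The third one bounds the total variation of [(|u|^2 - 1)^2] by a multiple of
    the energy and of the maximum of [|u|].  Evaluated at that maximum, this
    bounds [|u|] uniformly ([sup_bound]); it follows that every interval that is
    long compared with [eps] and contains a point where [|u|^2 <= 1/4] carries
    at least a fixed amount of energy ([bad_point_energy]).
    Along an ultrafilter that refines [eps -> 0], the
    points in whose every neighbourhood bad points persist therefore form a
    finite set [J], and any compact set [K] in (0, 1) minus [J] is eventually
    free of bad points.  Picking parameters in suitable sets of the
    ultrafilter, for an exhaustion of (0, 1) minus [J] by compact sets, gives
    the subsequence ([finite_concentration], [extract_sequence]).

    Where [u = rho exp(i theta)] with [rho > 0] one has [theta' = j / rho^2], so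
    the renormalized phase [v = theta / kap] has derivative
    [v' = j / (kap rho^2)], and
      [v' - 1 = (j - kap) / (kap rho^2) + (1 - rho^2) / rho^2]
    tends to 0 in L^2 by the first two bounds.  With [rho^2] replaced by
    [max(rho^2, 1/4)] the formula makes sense on the whole of (0, 1) and [v] can
    be defined as an integral; on each component of the complement of [J] a
    constant is added so that [exp(i kap v)] is the direction of [u] at one
    point of the component.  The constants are determined modulo the period
    [2 pi / kap = eps^beta], so they can be taken in an interval of that length,
    and they tend to 0 ([exists_phase], [lifting], [phase_H1norm]).

    For the weak convergence of [u], the identity
      [i j u = |u|^2 u' - (|u|^2)' u / 2]
    expresses [kap u] as the derivative of a bounded function, plus terms
    bounded in L^1: the means of [u] over intervals are [O(eps^beta)]
    ([segment_mean_bound]).  As [u] is bounded uniformly, this gives the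
    convergence against every integrable function ([weak_limit]), for the
    entire family.

    All computations on Sobolev functions are carried out on their absolutely
    continuous representatives ([primitive], [weak_derivative_primitive]).  The
    chain rule for these ([primitive_comp]) and the integration by parts behind
    [locally_primitive_weak_derivative] reduce to short intervals by Cousin's
    lemma ([cousin]). *)

(** * Absolutely continuous functions *)

Section RintegralBound.
Context d (T : measurableType d) (R : realType) (mu : {measure set T -> \bar R}).

Lemma ler_norm_Rintegral (D : set T) (g k : T -> R) : measurable D ->
  mu.-integrable D (EFin \o g) -> mu.-integrable D (EFin \o k) ->
  (forall x, D x -> `|g x| <= k x) ->
  `|\int[mu]_(x in D) g x| <= \int[mu]_(x in D) k x.
Proof.
move=> mD ig ik gk; apply: le_trans (le_normr_Rintegral mD ig) _.
by apply: le_Rintegral => //; exact: integrable_norm.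
Qed.

Lemma integrable_EFinD (D : set T) (g k : T -> R) : measurable D ->
  mu.-integrable D (EFin \o g) -> mu.-integrable D (EFin \o k) ->
  mu.-integrable D (EFin \o (fun x => g x + k x)).
Proof. by move=> mD ig ik; exact: (integrableD mD ig ik). Qed.

Lemma integrable_EFinB (D : set T) (g k : T -> R) : measurable D ->
  mu.-integrable D (EFin \o g) -> mu.-integrable D (EFin \o k) ->
  mu.-integrable D (EFin \o (fun x => g x - k x)).
Proof. by move=> mD ig ik; exact: (integrableB mD ig ik). Qed.

Lemma integrable_EFinZ (D : set T) (c : R) (g : T -> R) : measurable D ->
  mu.-integrable D (EFin \o g) -> mu.-integrable D (EFin \o (fun x => c * g x)).
Proof. by move=> mD ig; exact: (integrableZl mD c ig). Qed.

End RintegralBound.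

Section AbsoluteContinuity.
Context {R : realType}.
Implicit Types (a b x y z : R) (f g h : R -> R).
Local Notation mu := (@lebesgue_measure R).

Lemma within_segmentP a b f :
  {within `[a, b], continuous f} <->
  forall x, a <= x <= b -> forall e, 0 < e ->
    exists2 d, 0 < d & forall y, a <= y <= b -> `|y - x| < d -> `|f y - f x| < e.
Proof.
rewrite subspace_continuousP; split=> cf x xab.
- move=> e e0; move: (cf x); rewrite /= in_itv /= => /(_ xab) /cvgrPdist_lt.
  move=> /(_ e e0) [d /= d0 dP]; exists d => // y yab yx.
  by rewrite distrC; apply: dP => /=; rewrite ?in_itv //= distrC.
- apply/cvgrPdist_lt => e e0; move: xab; rewrite /= in_itv /= => xab.
  have [d d0 dP] := cf x xab e e0; exists d => //= y /= yx.
  by rewrite in_itv /= => yab; rewrite distrC; apply: dP => //; rewrite distrC.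
Qed.

(** Cousin's lemma, in the form of a passage from local to global: the
    supremum of the points [x] with [P a x] is in the set and cannot be smaller
    than [b]. *)
Lemma cousin (P : R -> R -> Prop) a b : a <= b ->
  (forall x y z, a <= x -> x <= y -> y <= z -> z <= b ->
     P x y -> P y z -> P x z) ->
  (forall z, a <= z <= b -> exists2 d, 0 < d & forall x y,
     a <= x -> x <= z -> z <= y -> y <= b -> z - d < x -> y < z + d -> P x y) ->
  P a b.
Proof.
move=> ab trP locP.
pose A := [set x | a <= x <= b /\ P a x].
have Aa : A a.
  split; first by rewrite lexx ab.
  have [|d d0] := locP a; first by rewrite lexx ab.
  by apply => //; rewrite ?ltrDl ?ltrBlDr ?ltrDl.
have hA : has_sup A.
  by split; [exists a | exists b => x [/andP[]]].
have as_ : a <= sup A by exact: (ub_le_sup hA.2 Aa).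
have sb : sup A <= b by apply: ge_sup; [exists a | move=> x [/andP[]]].
have [|d d0 dP] := locP (sup A); first by rewrite as_ sb.
have [x [/andP[ax xb] Pax] xs] := sup_adherent d0 hA.
have xles : x <= sup A by apply: (ub_le_sup hA.2); rewrite /A /= ax xb.
have Pay y : sup A <= y -> y <= b -> y < sup A + d -> P a y.
  move=> sy yb yd; apply: (trP a x y) => //; first exact: le_trans sy.
  by apply: dP.
have [sltb|bs] := ltP (sup A) b; last first.
  by apply: Pay => //; apply: (le_lt_trans bs); rewrite ltrDl.
pose y := Num.min b (sup A + d / 2).
have sy : sup A < y by rewrite /y lt_min sltb ltrDl divr_gt0.
have yb : y <= b by rewrite /y ge_min lexx.
suff : y <= sup A by rewrite leNgt sy.
apply: (ub_le_sup hA.2); split; first by rewrite yb (le_trans as_ (ltW sy)).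
apply: Pay => //; first exact: ltW.
by rewrite /y gt_min ltrD2l ltr_pdivrMr // ltr_pMr // ltrDl ltr01 orbT.
Qed.

Lemma Rintegral_segment_split f a b c : a <= b -> b <= c ->
  mu.-integrable `[a, c] (EFin \o f) ->
  \int[mu]_(t in `[a, c]) f t =
  \int[mu]_(t in `[a, b]) f t + \int[mu]_(t in `[b, c]) f t.
Proof.
move=> ab bc fi.
have E := @Rintegral_itvB R f (BLeft a) (BRight c) b fi.
rewrite -[X in _ = _ + X]Rintegral_itv_obnd_cbnd; last first.
  by apply: integrableS fi => //; apply: subset_itvr; rewrite bnd_simp.
by rewrite -E ?bnd_simp // addrC subrK.
Qed.

(** Absolutely continuous functions, presented with their derivative: [f] is
    an integral of the integrable function [h]. *)
Definition primitive a b f h : Prop :=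
  mu.-integrable `[a, b] (EFin \o h) /\
  forall x y, a <= x -> x <= y -> y <= b ->
    f y - f x = \int[mu]_(t in `[x, y]) h t.

Lemma integrable_subsegment a b x y h : a <= x -> y <= b ->
  mu.-integrable `[a, b] (EFin \o h) -> mu.-integrable `[x, y] (EFin \o h).
Proof.
move=> ax yb; apply: integrableS => //; apply: subset_itv; by rewrite bnd_simp.
Qed.

Lemma primitive_continuous a b f h : primitive a b f h ->
  {within `[a, b], continuous f}.
Proof.
move=> [ih fh]; have [ab|ba] := leP a b; last first.
  rewrite set_itv_ge ?bnd_simp -?ltNge //; exact: continuous_subspace0.
have := parameterized_integral_continuous ab ih.
rewrite !within_segmentP => cF x xab e e0.
have [d d0 dP] := cF x xab e e0; exists d => // y yab yx.
have fE z : a <= z <= b -> f z = f a + parameterized_integral mu a z h.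
  by case/andP=> az zb; rewrite /parameterized_integral -fh // subrKC.
by rewrite (fE _ yab) (fE _ xab) opprD addrACA subrr add0r; exact: dP.
Qed.

Lemma integrable_continuousM a b f h : {within `[a, b], continuous f} ->
  mu.-integrable `[a, b] (EFin \o h) ->
  mu.-integrable `[a, b] (EFin \o (fun t => f t * h t)).
Proof.
move=> cf ih; have mf : measurable_fun `[a, b] f.
  exact: subspace_continuous_measurable_fun.
have bf : [bounded f x | x in `[a, b]].
  have /compact_bounded[M [_ mrt]] := continuous_compact cf (@segment_compact _ a b).
  by exists M; split; rewrite ?num_real // => ? ? ? ?; exact: mrt.
by apply: (@integrableMr _ _ _ mu _ _ f (EFin \o h)).
Qed.

Lemma primitive_sub a b x y f h : a <= x -> y <= b ->
  primitive a b f h -> primitive x y f h.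
Proof.
move=> ax yb [ih fh]; split; first exact: integrable_subsegment ih.
move=> s t xs st ty; apply: fh => //; first exact: le_trans xs.
exact: le_trans ty yb.
Qed.

(** By the mean value theorem a C^1 function is strictly differentiable: the
    increment may be taken between two points different from [p]. *)
Lemma strict_derivative (F dF : R -> R) (p : R) :
  (\forall y \near p, is_derive (y : R) (1 : R) F (dF y)) -> {for p, continuous dF} ->
  forall e, 0 < e -> \forall d \near 0^'+, forall u v,
    `|u - p| < d -> `|v - p| < d -> `|F v - F u - dF p * (v - u)| <= e * `|v - u|.
Proof.
move=> dFE cdF e e0.
have {}cdF : \forall y \near p, `|dF y - dF p| < e.
  move/cvgrPdist_lt: cdF => /(_ e e0); apply: filterS => y.
  by rewrite distrC.
have [r /= r0 rP] : \forall y \near p, is_derive (y : R) (1 : R) F (dF y) /\ `|dF y - dF p| < e.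
  by apply: filterS2 dFE cdF => y.
near=> d => u v up vp.
have dr : d <= r by near: d; exact: nbhs_right_le.
wlog uv : u v up vp / u <= v.
  move=> H; have [|/ltW vu] := leP u v; first exact: H.
  have -> : F v - F u - dF p * (v - u) = - (F u - F v - dF p * (u - v)) by ring.
  by rewrite normrN [`|v - u|]distrC; exact: H.
have inP x : x \in `[u, v] -> is_derive x 1 F (dF x) /\ `|dF x - dF p| < e.
  rewrite in_itv /= => /andP[ux xv]; apply: rP => /=; apply: lt_le_trans dr.
  by move: up vp; rewrite distrC !ltr_norml => /andP[? ?] /andP[? ?]; lra.
have [||c cuv ->] := @MVT_segment R F dF u v uv.
- by move=> x xuv; apply: (inP _ _).1; exact: subset_itv_oo_cc xuv.
- by apply: derivable_within_continuous => x /inP[[]].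
rewrite -mulrBl normrM ler_wpM2r //; exact/ltW/(inP _ cuv).2.
Unshelve. all: by end_near. Qed.

(** Chain rule for [F o f] with [f] absolutely continuous and [F] C^1: by
    Cousin's lemma it is enough to compare the two sides on short intervals. *)
Lemma primitive_comp a b f h (F dF : R -> R) : primitive a b f h ->
  (forall x, a <= x <= b -> \forall y \near f x, is_derive (y : R) (1 : R) F (dF y)) ->
  (forall x, a <= x <= b -> {for f x, continuous dF}) ->
  primitive a b (F \o f) (fun t => dF (f t) * h t).
Proof.
move=> pf dFE cdF; have cf := primitive_continuous pf.
have [ih fh] := pf.
have cdFf : {within `[a, b], continuous (dF \o f)}.
  apply/subspace_continuousP => x xab.
  apply: (@cvg_comp _ _ _ f dF _ _ _ ((subspace_continuousP _ _).1 cf x xab)).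
  by apply: cdF; move: xab; rewrite /= in_itv.
have idh := integrable_continuousM cdFf ih.
have inh : mu.-integrable `[a, b] (EFin \o (fun t => `|h t|)).
  exact: integrable_norm ih.
split => // x y ax xy yb.
have key e : 0 < e ->
    `|F (f y) - F (f x) - \int[mu]_(t in `[x, y]) (dF (f t) * h t)| <=
    e * \int[mu]_(t in `[x, y]) `|h t|.
  move=> e0.
  (* Both sides are additive in the interval, so the estimate is transitive. *)
  pose P s t := `|F (f t) - F (f s) - \int[mu]_(u in `[s, t]) (dF (f u) * h u)| <=
    e * \int[mu]_(u in `[s, t]) `|h u|.
  apply: (@cousin P x y xy).
    move=> s t u xs st tu uy; rewrite /P => Pst Ptu.
    rewrite !(@Rintegral_segment_split _ s t u) //.
    + rewrite mulrDr; apply: le_trans (lerD Pst Ptu); apply: le_trans (ler_normD _ _).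
      by rewrite le_eqVlt; apply/orP; left; apply/eqP; congr (`|_|); lra.
    + exact: integrable_subsegment (le_trans ax xs) (le_trans uy yb) inh.
    + exact: integrable_subsegment (le_trans ax xs) (le_trans uy yb) idh.
  move=> z /andP[xz zy].
  have zab : a <= z <= b by rewrite (le_trans ax xz) (le_trans zy yb).
  have e20 : 0 < e / 2 by rewrite divr_gt0.
  have [r r0 [rP rQ]] : exists2 r, 0 < r & (forall u v, `|u - f z| < r ->
      `|v - f z| < r -> `|F v - F u - dF (f z) * (v - u)| <= e / 2 * `|v - u|) /\
      forall u, `|u - f z| < r -> `|dF u - dF (f z)| <= e / 2.
    have H1 := strict_derivative (dFE z zab) (cdF z zab) e20.
    have /cvgrPdist_le /(_ _ e20) [r1 /= r10 r1P] := cdF z zab.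
    near (0 : R)^'+ => r; exists r; first by near: r; exact: nbhs_right_gt.
    split; first by near: r.
    move=> u uz; rewrite distrC; apply: r1P => /=; rewrite distrC.
    by apply: lt_le_trans uz _; near: r; exact: nbhs_right_le.
  have [d d0 dP] := (within_segmentP a b f).1 cf z zab r r0.
  exists d => // s t xs sz zt ty zds tzd; rewrite /P.
  have as_ := le_trans ax xs; have tb := le_trans ty yb.
  have st := le_trans sz zt.
  have fzP u : s <= u -> u <= t -> `|f u - f z| < r.
    move=> su ut; apply: dP.
      by rewrite (le_trans as_ su) (le_trans ut tb).
    by rewrite ltr_norml; move: su ut zds tzd; clear; lra.
  have ihst : mu.-integrable `[s, t] (EFin \o h) by exact: integrable_subsegment ih.
  have inhst : mu.-integrable `[s, t] (EFin \o (fun t => `|h t|)).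
    exact: integrable_norm ihst.
  have idst : mu.-integrable `[s, t] (EFin \o (fun u => dF (f u) * h u)).
    by exact: integrable_subsegment idh.
  have icst : mu.-integrable `[s, t] (EFin \o (fun u => dF (f z) * h u)).
    exact: integrable_EFinZ.
  have fst : f t - f s = \int[mu]_(u in `[s, t]) h u by exact: fh.
  have -> : F (f t) - F (f s) - \int[mu]_(u in `[s, t]) (dF (f u) * h u) =
    (F (f t) - F (f s) - dF (f z) * (f t - f s)) -
    \int[mu]_(u in `[s, t]) (dF (f u) * h u - dF (f z) * h u).
    by rewrite RintegralB // RintegralZl // fst opprB addrA subrK.
  apply: le_trans (ler_normB _ _) _; rewrite [e in leRHS]splitr mulrDl lerD //.
    apply: le_trans (rP _ _ _ _) _; try exact: fzP.
    by rewrite ler_wpM2l ?(ltW e20) // fst; exact: le_normr_Rintegral.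
  rewrite -RintegralZl //; apply: ler_norm_Rintegral => //.
  - exact: integrable_EFinB.
  - exact: integrable_EFinZ.
  - move=> u /=; rewrite in_itv /= => /andP[su ut].
    by rewrite -mulrBl normrM ler_wpM2r //; apply: rQ; exact: fzP.
apply/eqP; rewrite -subr_eq0 -normr_le0; apply/ler_addgt0Pl => e e0; rewrite addr0.
have I0 : 0 <= \int[mu]_(t in `[x, y]) `|h t| by apply: Rintegral_ge0.
have I1 : 0 < 1 + \int[mu]_(t in `[x, y]) `|h t| by lra.
apply: le_trans (key (e / (1 + \int[mu]_(t in `[x, y]) `|h t|)) _) _.
  by rewrite divr_gt0.
by rewrite -mulrA ler_piMr ?(ltW e0) // mulrC ler_pdivrMr // mul1r lerDr.
Unshelve. all: by end_near. Qed.

End AbsoluteContinuity.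

(** * Calculus of absolutely continuous functions *)

Section PrimitiveCalculus.
Context {R : realType}.
Implicit Types (a b x y z : R) (f g h : R -> R).
Local Notation mu := (@lebesgue_measure R).

Lemma eq_primitive a b f f1 h h1 : (forall x, a <= x <= b -> f x = f1 x) ->
  (forall x, a <= x <= b -> h x = h1 x) -> primitive a b f h -> primitive a b f1 h1.
Proof.
move=> ff hh [ih fh]; split.
  apply: eq_integrable ih => // x /set_mem/=; rewrite in_itv /= => /hh.
  by move=> ->.
move=> x y ax xy yb; rewrite -!ff ?fh //; last 2 first.
  by rewrite ax (le_trans xy).
  by rewrite yb (le_trans ax).
apply: eq_Rintegral => t /set_mem/=; rewrite in_itv /= => /andP[xt ty].
by rewrite hh // (le_trans ax) // (le_trans ty).
Qed.

Lemma lebesgue_measure_segment x y : x <= y -> mu `[x, y] = (y - x)%:E.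
Proof.
move=> xy; rewrite lebesgue_measure_itv /= lte_fin EFinB.
by move: xy; rewrite le_eqVlt => /predU1P[->|->]; rewrite ?ltxx ?subee.
Qed.

Lemma Rintegral_segment_cst x y (c : R) : x <= y ->
  \int[mu]_(t in `[x, y]) c = c * (y - x).
Proof.
move=> xy; rewrite Rintegral_cst //; congr (_ * _).
by rewrite -[RHS]/(fine (y - x)%:E) -lebesgue_measure_segment.
Qed.

Lemma primitive_cst a b (c : R) : primitive a b (fun=> c) (fun=> 0).
Proof.
split; first exact: (integrable0 mu).
by move=> x y *; rewrite subrr Rintegral_cst // mul0r.
Qed.

Lemma primitive_id a b : primitive a b id (fun=> 1).
Proof.
split.
  apply: continuous_compact_integrable; first exact: segment_compact.
  by apply: continuous_subspaceT => x; exact: cvg_cst.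
by move=> x y ax xy yb; rewrite Rintegral_segment_cst // mul1r.
Qed.

Lemma primitiveD a b f g h k : primitive a b f h -> primitive a b g k ->
  primitive a b (fun x => f x + g x) (fun x => h x + k x).
Proof.
move=> [ih fh] [ik gk]; split; first exact: integrable_EFinD.
move=> x y ax xy yb; rewrite RintegralD //; try exact: integrable_subsegment ax yb _.
by rewrite -fh // -gk //; ring.
Qed.

Lemma primitiveZ a b (c : R) f h : primitive a b f h ->
  primitive a b (fun x => c * f x) (fun x => c * h x).
Proof.
move=> [ih fh]; split; first exact: integrable_EFinZ.
move=> x y ax xy yb; rewrite RintegralZl //; last exact: integrable_subsegment ax yb _.
by rewrite -fh //; ring.
Qed.

Lemma primitiveB a b f g h k : primitive a b f h -> primitive a b g k ->
  primitive a b (fun x => f x - g x) (fun x => h x - k x).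
Proof.
move=> pf /(primitiveZ (-1)) pg.
apply: eq_primitive (primitiveD pf pg) => x _; ring.
Qed.

(** A C^1 function is the composite of itself with the absolutely continuous
    function [id]. *)
Lemma primitive_C1 a b (F dF : R -> R) : (forall x : R, is_derive x (1 : R) F (dF x)) ->
  continuous dF -> primitive a b F dF.
Proof.
move=> FdF cdF.
have := @primitive_comp _ a b id (fun=> 1) F dF (primitive_id a b).
have nFdF x : a <= x <= b -> \forall y \near x, is_derive (y : R) (1 : R) F (dF y).
  by move=> _; exists 1 => /=. 
move=> /(_ nFdF (fun x _ => cdF x)).
by apply: eq_primitive => // x _; rewrite mulr1.
Qed.

Lemma primitive_sqr a b f h : primitive a b f h ->
  primitive a b (fun x => f x ^+ 2) (fun x => 2 * f x * h x).
Proof.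
move=> pf; apply: (@primitive_comp _ _ _ f h (fun x => x ^+ 2) (fun x => 2 * x)) => //.
  move=> x _; exists 1 => //= y _; apply: is_derive_eq.
  by rewrite /GRing.scale /=; ring.
by move=> x _; apply: continuousM; [exact: cvg_cst | exact: cvg_id].
Qed.

(** Product rule, from the square rule by polarization. *)
Lemma primitiveM a b f g h k : primitive a b f h -> primitive a b g k ->
  primitive a b (fun x => f x * g x) (fun x => f x * k x + g x * h x).
Proof.
move=> pf pg; have ps := primitive_sqr (primitiveD pf pg).
have := primitiveZ (1 / 2) (primitiveB (primitiveB ps (primitive_sqr pf)) (primitive_sqr pg)).
by apply: eq_primitive => x _; field.
Qed.

Lemma primitive_integral a b (c : R) h : mu.-integrable `[a, b] (EFin \o h) ->
  primitive a b (fun x => c + \int[mu]_(t in `[a, x]) h t) h.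
Proof.
move=> ih; split=> // x y ax xy yb.
rewrite (@Rintegral_segment_split _ h a x y) //; first by ring.
exact: integrable_subsegment ih.
Qed.

Lemma primitive_test U (phi : R -> R) a b : test_function U phi ->
  primitive a b phi (derive1 phi).
Proof.
case=> dphi cphi _ _; apply: primitive_C1 => // x.
by apply: DeriveDef => //; rewrite derive1E.
Qed.

Lemma Rintegral_oo_cc a b h : mu.-integrable `[a, b] (EFin \o h) ->
  \int[mu]_(t in `]a, b[) h t = \int[mu]_(t in `[a, b]) h t.
Proof.
move=> ih; rewrite Rintegral_itv_bndo_bndc; last first.
  by apply: integrableS ih => //; exact: subset_itv_oo_cc.
rewrite Rintegral_itv_obnd_cbnd //.
by apply: integrableS ih => //; exact: subset_itv_oc_cc.
Qed.

Lemma integrable_oo_cc a b h : mu.-integrable `]a, b[ (EFin \o h) ->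
  mu.-integrable `[a, b] (EFin \o h).
Proof.
move=> /integrableP[/measurable_EFinP mh ih]; apply/integrableP.
have mh' : measurable_fun `[a, b] h by exact: measurable_fun_itv_cc mh.
split; first exact/measurable_EFinP.
apply: le_lt_trans ih; rewrite integral_itv_bndoo //.
apply: measurableT_comp => //; apply/measurable_EFinP => //.
Qed.

End PrimitiveCalculus.

(** * Test functions close to the indicator of an interval *)

Section Plateau.
Context {R : realType}.
Implicit Types (a b x y z : R) (f g h : R -> R).
Local Notation mu := (@lebesgue_measure R).

(** Functions of class C^{1,1}, with their derivative.  The estimate is stable
    under affine changes of variable and linear combinations, and gives the
    derivative and its continuity at once. *)
Definition C11 f (df : R -> R) : Prop :=
  exists2 K, 0 <= K & forall t s, `|f (t + s) - f t - df t * s| <= K * s ^+ 2.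

Lemma C11_lincomb f df g dg (c d : R) : C11 f df -> C11 g dg ->
  C11 (fun t => c * f t + d * g t) (fun t => c * df t + d * dg t).
Proof.
move=> [K K0 fK] [M M0 gM]; exists (`|c| * K + `|d| * M).
  by rewrite addr_ge0 // mulr_ge0.
move=> t s.
have -> : c * f (t + s) + d * g (t + s) - (c * f t + d * g t) -
    (c * df t + d * dg t) * s =
  c * (f (t + s) - f t - df t * s) + d * (g (t + s) - g t - dg t * s) by ring.
rewrite (le_trans (ler_normD _ _)) // !normrM mulrDl -!mulrA.
by rewrite lerD // ler_wpM2l.
Qed.

Lemma C11_affine f df (c d : R) : C11 f df ->
  C11 (fun t => f (c * t + d)) (fun t => c * df (c * t + d)).
Proof.
move=> [K K0 fK]; exists (K * c ^+ 2); first by rewrite mulr_ge0 ?sqr_ge0.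
move=> t s; have := fK (c * t + d) (c * s).
by rewrite exprMn mulrA mulrA [df _ * c]mulrC (_ : c * t + d + c * s = c * (t + s) + d) //; ring.
Qed.

Lemma C11_lipschitz f df : C11 f df ->
  exists2 K, 0 <= K & forall t s, `|df (t + s) - df t| <= K * `|s|.
Proof.
move=> [K K0 fK]; exists (2 * K); first by rewrite mulr_ge0.
move=> t s; have [->|s0] := eqVneq s 0; first by rewrite addr0 subrr normr0 mulr0.
have s0' : 0 < `|s| by rewrite normr_gt0.
have sK : 2 * K * `|s| * `|s| = 2 * K * s ^+ 2.
  by rewrite -[s ^+ 2]real_normK ?num_real //; ring.
rewrite -(ler_pM2r s0') -normrM sK.
have := fK (t + s) (- s); have := fK t s.
rewrite addrK sqrrN mulrN opprK => H1 H2.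
have -> : (df (t + s) - df t) * s =
  (f (t + s) - f t - df t * s) + (f t - f (t + s) + df (t + s) * s) by ring.
by rewrite (le_trans (ler_normD _ _)) //; lra.
Qed.

Lemma C11_continuous f df : C11 f df -> continuous df.
Proof.
move=> /C11_lipschitz [K K0 dK] t; apply/cvgrPdist_lt => e e0.
exists (e / (K + 1)) => /=; first by rewrite divr_gt0 // ltr_wpDl.
move=> s /=; rewrite distrC => ts.
rewrite distrC -(subrKC t s) (le_lt_trans (dK _ _)) //.
have : (K + 1) * `|s - t| < e by rewrite mulrC -ltr_pdivlMr // ltr_wpDl.
by have := normr_ge0 (s - t); nra.
Qed.

Lemma C11_is_derive f df t : C11 f df -> is_derive t (1 : R) f (df t).
Proof.
move=> [K K0 fK].
have cv : (fun s => s^-1 *: (f (s *: (1 : R) + t) - f t)) @ 0^' --> df t.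
  apply/cvgrPdist_lt => e e0.
  exists (e / (K + 1)) => /=; first by rewrite divr_gt0 // ltr_wpDl.
  move=> s /=; rewrite sub0r normrN => ts s0.
  have s0' : 0 < `|s| by rewrite normr_gt0.
  rewrite distrC /GRing.scale /= mulr1 [s + t]addrC.
  rewrite -(ltr_pM2r s0') -normrM mulrBl.
  have -> : s^-1 * (f (t + s) - f t) * s = f (t + s) - f t by field.
  rewrite (le_lt_trans (fK _ _)) // -real_normK ?num_real // expr2 mulrA ltr_pM2r //.
  have : (K + 1) * `|s| < e by rewrite mulrC -ltr_pdivlMr // ltr_wpDl.
  by nra.
apply: DeriveDef; first by apply/cvg_ex; exists (df t).
exact: (cvg_lim _ cv).
Qed.

(** The square of the positive part, the building block of the step. *)
Lemma C11_pos2 : C11 (fun t : R => t * Num.max t 0) (fun t => 2 * Num.max t 0).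
Proof.
exists 1 => // t s; rewrite ler_norml mul1r.
have [t0|t0] := leP t 0; have [s0|s0] := leP (t + s) 0; apply/andP; split; nra.
Qed.

(** A C^1 step from 0 to 1, whose derivative is the hat function on [0, 2]. *)
Definition step (t : R) : R :=
  1 / 2 * (t * Num.max t 0) + - 1 * ((t - 1) * Num.max (t - 1) 0)
  + 1 / 2 * ((t - 2) * Num.max (t - 2) 0).

Definition hat (t : R) : R :=
  1 / 2 * (2 * Num.max t 0) + - 1 * (2 * Num.max (t - 1) 0)
  + 1 / 2 * (2 * Num.max (t - 2) 0).

Lemma C11_step : C11 step hat.
Proof.
have sh c : C11 (fun t : R => (t - c) * Num.max (t - c) 0) (fun t => 2 * Num.max (t - c) 0).
  have := C11_affine 1 (- c) C11_pos2.
  by under eq_fun do rewrite mul1r; under [X in C11 _ X]eq_fun do rewrite !mul1r.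
have := C11_lincomb 1 (1 / 2) (C11_lincomb (1 / 2) (-1) C11_pos2 (sh 1)) (sh 2).
by under eq_fun do rewrite mul1r; under [X in C11 _ X]eq_fun do rewrite mul1r.
Qed.

Lemma stepE0 t : t <= 0 -> step t = 0.
Proof. by rewrite /step => t0; rewrite !max_r //; lra. Qed.

Lemma stepE1 t : 2 <= t -> step t = 1.
Proof. by rewrite /step => t2; rewrite !max_l //; [field | lra..]. Qed.

Lemma step_01 t : 0 <= step t <= 1.
Proof.
rewrite /step; have [t0|t0] := leP t 0; have [t1|t1] := leP (t - 1) 0;
  have [t2|t2] := leP (t - 2) 0; apply/andP; split; nra.
Qed.

Lemma hat_ge0 t : 0 <= hat t.
Proof.
by rewrite /hat; have [t0|t0] := leP t 0; have [t1|t1] := leP (t - 1) 0;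
  have [t2|t2] := leP (t - 2) 0; lra.
Qed.

Lemma hat_neq0 t : hat t != 0 -> 0 < t < 2.
Proof.
apply: contraR; rewrite negb_and -!leNgt => /orP[] H; apply/eqP; rewrite /hat.
  by rewrite !max_r; lra.
by rewrite !max_l; lra.
Qed.

(** The ramps sit in [x + 1/N, x + 3/N] and in [y - 3/N, y - 1/N], so that the
    support stays inside ]x, y[ and may be used up to the endpoints of the
    domain. *)
Definition plateau x y (N t : R) : R :=
  1 * step (N * t + (- (N * x) - 1)) + - 1 * step (N * t + (- (N * y) + 3)).

Definition dplateau x y (N t : R) : R :=
  1 * (N * hat (N * t + (- (N * x) - 1))) +
  - 1 * (N * hat (N * t + (- (N * y) + 3))).

Lemma C11_plateau x y (N : R) : C11 (plateau x y N) (dplateau x y N).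
Proof. by apply: C11_lincomb; apply: C11_affine; exact: C11_step. Qed.

Lemma plateau_bound x y (N t : R) : `|plateau x y N t| <= 1.
Proof.
rewrite /plateau ler_norml.
have := step_01 (N * t + (- (N * x) - 1)); have := step_01 (N * t + (- (N * y) + 3)).
by lra.
Qed.

Lemma plateau_eq0 x y (N t : R) : 4 <= N * (y - x) -> 0 < N ->
  plateau x y N t != 0 -> x + N^-1 < t < y - N^-1.
Proof.
move=> N4 N0; apply: contraR; rewrite negb_and -!leNgt /plateau => /orP[] H.
  have : N * t <= N * x + 1 by have := ler_wpM2l (ltW N0) H; rewrite mulrDr divff ?gt_eqF.
  by move=> ?; rewrite !stepE0; lra.
have : N * y - 1 <= N * t by have := ler_wpM2l (ltW N0) H; rewrite mulrBr divff ?gt_eqF.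
by move=> ?; rewrite !stepE1; lra.
Qed.

Lemma derive1_plateau x y (N : R) : derive1 (plateau x y N) = dplateau x y N.
Proof.
apply/funext => t; rewrite derive1E.
by have [] := C11_is_derive t (C11_plateau x y N).
Qed.

Lemma test_plateau (U : set R) x y (N : R) : `]x, y[ `<=` U ->
  4 <= N * (y - x) -> 0 < N -> test_function U (plateau x y N).
Proof.
move=> xyU N4 N0.
have supp : closure [set t | plateau x y N t != 0] `<=` `[x + N^-1, y - N^-1].
  have /closure_id -> : closed `[x + N^-1, y - N^-1] by exact: itv_closed.
  apply: closureS => t /= /plateau_eq0 => /(_ N4 N0).
  by rewrite in_itv /= => /andP[H1 H2]; rewrite !ltW.
split.
- by move=> t; have [] := C11_is_derive t (C11_plateau x y N).
- by rewrite derive1_plateau; exact: C11_continuous (C11_plateau x y N).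
- by apply: subclosed_compact supp; [exact: closed_closure | exact: segment_compact].
- apply: subset_trans supp _; apply: subset_trans xyU => t /=; rewrite !in_itv /=.
  have N1 : 0 < N^-1 by rewrite invr_gt0.
  by move: N1; clear; lra.
Qed.

End Plateau.

(** * Continuous functions with an integrable weak derivative *)

Section WeakToPrimitive.
Context {R : realType}.
Implicit Types (a b x y z : R) (f g h : R -> R) (U : set R).
Local Notation mu := (@lebesgue_measure R).

Lemma plateau_off x y (N : R) t : 4 <= N * (y - x) -> 0 < N ->
  ~ (x < t < y) -> plateau x y N t = 0.
Proof.
move=> N4 N0 ntxy; apply: contra_notP ntxy => /eqP/(plateau_eq0 N4 N0).
have : 0 < N^-1 by rewrite invr_gt0.
by clear; lra.
Qed.

Lemma plateau_on x y t : x < t < y ->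
  \forall n \near \oo, plateau x y n%:R t = 1.
Proof.
move=> /andP[xt ty]; near=> n; rewrite /plateau.
have N1 : 3 < n%:R * (t - x).
  rewrite -ltr_pdivrMr ?subr_gt0 //; near: n; exact: nbhs_infty_gtr.
have N2 : 3 < n%:R * (y - t).
  rewrite -ltr_pdivrMr ?subr_gt0 //; near: n; exact: nbhs_infty_gtr.
rewrite [step (_ + (_ - 1))]stepE1; last by lra.
by rewrite stepE0; lra.
Unshelve. all: by end_near. Qed.

Lemma measurable_plateau U x y (N : R) : measurable_fun U (plateau x y N).
Proof.
apply: (@measurable_funTS _ _ _ _ _ (plateau x y N)).
apply: continuous_measurable_fun => t.
have [+ _] := C11_is_derive t (C11_plateau x y N).
by move/derivable1_diffP/differentiable_continuous.
Qed.

Lemma integrable_plateauM U x y (N : R) g : measurable U ->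
  mu.-integrable U (EFin \o g) ->
  mu.-integrable U (EFin \o (fun t => g t * plateau x y N t)).
Proof.
move=> mU ig; apply: (le_integrable _ _ _ (integrable_norm ig)) => //.
  apply/measurable_EFinP; apply: measurable_funM; last exact: measurable_plateau.
  by case/integrableP: ig => /measurable_EFinP.
move=> t Ut /=; rewrite lee_fin normrM [leRHS]normr_id.
by rewrite ler_piMr // plateau_bound.
Qed.

(** Dominated convergence: the plateaus are bounded by 1 and tend pointwise to
    the indicator of ]x, y[. *)
Lemma plateau_limit U x y g : measurable U -> x < y -> `]x, y[ `<=` U ->
  mu.-integrable U (EFin \o g) ->
  \int[mu]_(t in U) (g t * plateau x y n%:R t) @[n --> \oo] -->
  \int[mu]_(t in `]x, y[) g t.
Proof.
move=> mU xy xyU ig.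
have mg : measurable_fun U g by case/integrableP: ig => /measurable_EFinP.
have [N N0 NP] : exists2 N : nat, True & forall n, (N <= n)%N -> 4 <= n%:R * (y - x) /\ 0 < n%:R :> R.
  have [N _ NP] : \forall n \near \oo, 4 / (y - x) <= n%:R :> R by exact: nbhs_infty_ger.
  exists N => // n /NP /=; rewrite ler_pdivrMr ?subr_gt0 // => H; split=> //.
  by rewrite ltr0n lt0n; apply: contraTneq H => ->; rewrite mul0r; lra.
(* The plateau is supported in ]x, y[ only for large parameters, hence the
   shift of the sequence by [N]. *)
pose F n t := (g t * plateau x y (n + N)%:R t)%:E.
have [|||||_ _] := @dominated_convergence _ _ R mu U mU F
   (fun t => ((g \_ `]x, y[) t)%:E) (fun t => `|g t|%:E).
- move=> n; apply/measurable_EFinP; apply: measurable_funM => //; exact: measurable_plateau.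
- apply/measurable_EFinP; apply/measurable_restrict => //.
  by apply: measurable_funS mg => //; exact: subIsetl.
- apply: aeW => t Ut; rewrite /F patchE; case: ifPn => [/set_mem|/negP H].
    rewrite /= in_itv /= => txy; apply: cvg_near_cst.
    have [M _ MP] := plateau_on txy.
    exists M => // n /= Mn; rewrite MP ?mulr1 //=; exact: leq_trans (leq_addr _ _).
  apply: cvg_near_cst; apply: nearW => n.
  have [n4 n0] := NP (n + N)%N (leq_addl _ _).
  rewrite plateau_off ?mulr0 // => txy; apply: H; apply/mem_set.
  by rewrite /= in_itv.
- exact: integrable_norm.
- apply: aeW => t n Ut; rewrite /F /= lee_fin normrM ler_piMr //; exact: plateau_bound.
have igr : mu.-integrable U (EFin \o (g \_ `]x, y[)).
  apply: (le_integrable _ _ _ (integrable_norm ig)) => //.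
    apply/measurable_EFinP/measurable_restrict => //.
    by apply: measurable_funS mg => //; exact: subIsetl.
  move=> t Ut /=; rewrite lee_fin [leRHS]normr_id patchE.
  by case: ifP; rewrite // normr0.
have -> : (\int[mu]_(t in U) ((g \_ `]x, y[) t)%:E)%E =
    (\int[mu]_(t in `]x, y[) g t)%:E.
  rewrite -[in RHS](setIidr xyU) Rintegral_mkcondr /Rintegral fineK //.
  exact: integrable_fin_num igr.
pose G n := \int[mu]_(t in U) (g t * plateau x y n%:R t).
by move/fine_cvg => cF; rewrite -(cvg_shiftn N G).
Qed.

(** A nonnegative kernel of mass one reproduces [f z] up to the oscillation of
    [f] on its support. *)
Lemma kernel_average a b f w z (e : R) : a <= b -> {within `[a, b], continuous f} ->
  (forall t, 0 <= w t) -> mu.-integrable `[a, b] (EFin \o w) ->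
  \int[mu]_(t in `[a, b]) w t = 1 ->
  (forall t, a <= t <= b -> w t != 0 -> `|f t - f z| <= e) ->
  `|\int[mu]_(t in `[a, b]) (f t * w t) - f z| <= e.
Proof.
move=> ab cf w0 iw w1 we.
have ifw := integrable_continuousM cf iw.
have izw : mu.-integrable `[a, b] (EFin \o (fun t => f z * w t)).
  exact: integrable_EFinZ.
have -> : f z = \int[mu]_(t in `[a, b]) (f z * w t).
  by rewrite RintegralZl // w1 mulr1.
rewrite -RintegralB //.
have -> : e = \int[mu]_(t in `[a, b]) (e * w t) by rewrite RintegralZl // w1 mulr1.
apply: ler_norm_Rintegral => //.
- exact: integrable_EFinB.
- exact: integrable_EFinZ.
move=> t /=; rewrite in_itv /= => tab; rewrite -mulrBl normrM (ger0_norm (w0 t)).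
have [->|wt] := eqVneq (w t) 0; first by rewrite !mulr0.
by apply: ler_wpM2r => //; exact: we.
Qed.

Lemma hat_kernel a b f z (N c : R) : a <= b -> {within `[a, b], continuous f} ->
  0 < N -> N * a + c <= 0 -> 2 <= N * b + c ->
  forall e, (forall t, a <= t <= b -> 0 < N * t + c < 2 -> `|f t - f z| <= e) ->
  `|\int[mu]_(t in `[a, b]) (f t * (N * hat (N * t + c))) - f z| <= e.
Proof.
move=> ab cf N0 Na Nb e we.
have C := C11_affine N c C11_step.
have [iw w1] := @primitive_C1 _ a b _ _ (fun x => C11_is_derive x C) (C11_continuous C).
apply: kernel_average => //.
- by move=> t; rewrite mulr_ge0 ?hat_ge0 // ltW.
- by rewrite -w1 // stepE1 // stepE0 // subr0.
- move=> t tab; rewrite mulf_eq0 negb_or => /andP[_ /hat_neq0]; exact: we.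
Qed.

(** Testing against plateau functions identifies the continuous representative
    of a Sobolev function as an integral of its weak derivative, up to the
    endpoints. *)
Lemma weak_derivative_primitive a b f h : a < b ->
  {within `[a, b], continuous f} -> mu.-integrable `]a, b[ (EFin \o h) ->
  is_weak_derivative `]a, b[ f h -> primitive a b f h.
Proof.
move=> ab cf ih fh.
have ihc := integrable_oo_cc ih.
split=> // x y ax; rewrite le_eqVlt => /predU1P[<- _|xy yb].
  by rewrite subrr set_itv1 Rintegral_set1.
rewrite -Rintegral_oo_cc; last exact: integrable_subsegment ihc.
have xyU : `]x, y[ `<=` `]a, b[ by apply: subset_itv; rewrite bnd_simp.
have lim := plateau_limit (measurable_itv _) xy xyU ih.
apply/eqP; rewrite -subr_eq0 -normr_le0; apply/ler_addgt0Pl => e e0; rewrite addr0.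
have e30 : 0 < e / 3 by rewrite divr_gt0.
have xab : a <= x <= b by rewrite ax (le_trans (ltW xy)).
have yab : a <= y <= b by rewrite yb (le_trans ax) ?ltW.
have [d1 d10 d1P] := (within_segmentP a b f).1 cf x xab _ e30.
have [d2 d20 d2P] := (within_segmentP a b f).1 cf y yab _ e30.
move/cvgrPdist_lt : lim => /(_ _ e30) lim.
near \oo => n.
have n0 : 0 < n%:R :> R by near: n; exact: nbhs_infty_gtr.
have n4 : 4 < n%:R * (y - x).
  rewrite -ltr_pdivrMr ?subr_gt0 //; near: n; exact: nbhs_infty_gtr.
have nd1 : 3 < n%:R * d1 by rewrite -ltr_pdivrMr //; near: n; exact: nbhs_infty_gtr.
have nd2 : 3 < n%:R * d2 by rewrite -ltr_pdivrMr //; near: n; exact: nbhs_infty_gtr.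
have nya : n%:R * (y - x) <= n%:R * (y - a) by rewrite ler_pM2l // lerD2l lerN2.
have nbx : n%:R * (y - x) <= n%:R * (b - x) by rewrite ler_pM2l // lerD2r.
have nax : n%:R * a <= n%:R * x by rewrite ler_pM2l.
have nyb : n%:R * y <= n%:R * b by rewrite ler_pM2l.
have := fh _ (test_plateau xyU (ltW n4) n0).
rewrite derive1_plateau.
have limn : `|\int[mu]_(t in `]x, y[) h t -
   \int[mu]_(t in `]a, b[) (h t * plateau x y n%:R t)| < e / 3 by near: n.
have cp := C11_continuous (C11_plateau x y n%:R).
have cfp : {within `[a, b], continuous (dplateau x y n%:R)} by exact: continuous_subspaceT.
have C1 := C11_continuous (C11_affine n%:R (- (n%:R * x) - 1) C11_step).
have C2 := C11_continuous (C11_affine n%:R (- (n%:R * y) + 3) C11_step).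
have ic (w : R -> R) : continuous w -> mu.-integrable `[a, b] (EFin \o (fun t => f t * w t)).
  move=> cw; apply: integrable_continuousM => //.
  apply: continuous_compact_integrable; first exact: segment_compact.
  exact: continuous_subspaceT.
rewrite Rintegral_oo_cc; last exact: ic.
have -> : \int[mu]_(t in `[a, b]) (f t * dplateau x y n%:R t) =
  \int[mu]_(t in `[a, b]) (f t * (n%:R * hat (n%:R * t + (- (n%:R * x) - 1)))) -
  \int[mu]_(t in `[a, b]) (f t * (n%:R * hat (n%:R * t + (- (n%:R * y) + 3)))).
  rewrite -RintegralB //; try exact: ic.
  by apply: eq_Rintegral => t _; rewrite /dplateau; ring.
have H1 : `|\int[mu]_(t in `[a, b]) (f t * (n%:R * hat (n%:R * t + (- (n%:R * x) - 1)))) - f x| <= e / 3.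
  apply: hat_kernel => //; [exact: ltW | lra | lra |].
  move=> t tab /andP[Ht1 Ht2]; apply/ltW/d1P => //.
  rewrite -(ltr_pM2l n0) -[n%:R in ltLHS]gtr0_norm // -normrM ltr_norml; lra.
have H2 : `|\int[mu]_(t in `[a, b]) (f t * (n%:R * hat (n%:R * t + (- (n%:R * y) + 3)))) - f y| <= e / 3.
  apply: hat_kernel => //; [exact: ltW | lra | lra |].
  move=> t tab /andP[Ht1 Ht2]; apply/ltW/d2P => //.
  rewrite -(ltr_pM2l n0) -[n%:R in ltLHS]gtr0_norm // -normrM ltr_norml; lra.
move=> E; move: limn H1 H2 E; clear.
set A := Rintegral _ _ _; set B := Rintegral _ _ _.
set C := Rintegral _ _ _; set D := Rintegral _ _ _.
rewrite ltr_norml !ler_norml => /andP[? ?] /andP[? ?] /andP[? ?] ?.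
by apply/andP; split; lra.
Unshelve. all: by end_near. Qed.

End WeakToPrimitive.

(** * Uniqueness of the weak derivative, and the norm of L^2 *)

Section IntegrableRestrict.
Context d (T : measurableType d) (R : realType) (mu : {measure set T -> \bar R}).

Lemma integrable_restrictT (D : set T) (f : T -> R) : measurable D ->
  mu.-integrable D (EFin \o f) -> mu.-integrable [set: T] (EFin \o (f \_ D)).
Proof.
by move=> mD if_; rewrite -restrict_EFin; exact: (integrable_mkcond _ mD).1.
Qed.

Lemma Lnorm2_restrict (D : set T) (f : T -> R) :
  ('N[mu]_2%:E[EFin \o (f \_ D)] = (\int[mu]_(x in D) (f x ^+ 2)%:E) `^ 2^-1)%E.
Proof.
rewrite unlock /Lnorm; congr (_ `^ _)%E; rewrite [RHS]integral_mkcond.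
apply: eq_integral => x _; rewrite !patchE /= patchE; case: ifP => _.
  by rewrite powR_mulrn // real_normK ?num_real.
by rewrite normr0 powR0.
Qed.

Lemma Lfun2_restrictP (D : set T) (f : T -> R) : measurable D ->
  f \_ D \in Lfun mu 2%:E <->
  measurable_fun D f /\ mu.-integrable D (EFin \o (fun x => f x ^+ 2)).
Proof.
move=> mD; split=> [fL|[mf if2]].
  have mf : measurable_fun D f.
    apply/(measurable_restrictT f mD).2.
    by move: fL; rewrite inE => /andP[]; rewrite inE.
  split => //; have := Lfun2_integrable_sqr fL.
  move=> /(integrableS measurableT mD (@subsetT _ _)).
  apply: eq_integrable => // x xD; congr (_ ^+ 2)%:E.
  by rewrite patchE xD.
rewrite inE; apply/andP; split.
  by rewrite inE; exact/(measurable_restrictT f mD).1.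
rewrite inE /= /finite_norm Lnorm2_restrict poweR_lty //.
case/integrableP: if2 => mf2; apply: le_lt_trans.
apply: ge0_le_integral => //.
- by move=> x _; rewrite lee_fin sqr_ge0.
- exact: measurableT_comp.
- by move=> x _ /=; rewrite lee_fin ler_norm.
Qed.

End IntegrableRestrict.

Section WeakDerivativeUniqueness.
Context {R : realType}.
Implicit Types (a b x y z : R) (f g h : R -> R) (U D : set R).
Local Notation mu := (@lebesgue_measure R).

(** The indefinite integral is locally constant where all the integrals over
    intervals vanish. *)
Lemma Rintegral_oo0_derive (d : R -> R) U x : open U -> U x ->
  mu.-integrable [set: R] (EFin \o d) ->
  (forall s t, s < t -> `]s, t[ `<=` U -> \int[mu]_(u in `]s, t[) d u = 0) ->
  derive1 (fun y => \int[mu]_(t in `]-oo, y]) d t) x = 0.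
Proof.
move=> oU Ux id d0.
have idS (D : set (measurableTypeR R)) : measurable D -> mu.-integrable D (EFin \o d).
  by move=> mD; exact: integrableS id.
have incr s t : s <= t -> `]s, t[ `<=` U ->
    \int[mu]_(u in `]-oo, s]) d u = \int[mu]_(u in `]-oo, t]) d u.
  rewrite le_eqVlt => /predU1P[->//|st] stU.
  have := @Rintegral_itvB _ d -oo%O (BRight t) s (idS _ (measurable_itv _)).
  rewrite !bnd_simp => /(_ isT (ltW st)) /eqP.
  rewrite -[X in _ == X]Rintegral_itv_bndo_bndc; last exact: idS.
  by rewrite (d0 _ _ st) // subr_eq0 => /eqP.
rewrite derive1E.
transitivity ('D_1 (cst (\int[mu]_(t in `]-oo, x]) d t)) x : R); last exact: derive_cst.
apply: near_eq_derive.
have [r /= r0 rU] : \forall y \near x, U y by exact: open_nbhs_nbhs.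
exists r => //= y xy.
have [le_yx|/ltW le_xy] := leP y x; [|apply/esym]; apply: incr => // u;
  rewrite /= in_itv /= => H; apply: rU => /=; move: xy H; rewrite /ball_ /= !ltr_norml; clear; lra.
Qed.

(** Testing against plateaus, the difference [d] of two weak derivatives has
    integral 0 over every interval in [U]; at its Lebesgue points it is then the
    derivative of a locally constant function. *)
Lemma weak_derivative_unique U f g h : open U ->
  mu.-integrable U (EFin \o g) -> mu.-integrable U (EFin \o h) ->
  is_weak_derivative U f g -> is_weak_derivative U f h ->
  ae_eq mu U (EFin \o g) (EFin \o h).
Proof.
move=> oU ig ih fg fh.
have mU : measurable U by exact: open_measurable.
pose d := (fun x => g x - h x) \_ U.
have igh : mu.-integrable U (EFin \o (fun x => g x - h x)) by exact: integrable_EFinB.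
have idT : mu.-integrable [set: R] (EFin \o d).
  by apply: (@integrable_restrictT _ _ _ mu).
have d0 s t : s < t -> `]s, t[ `<=` U -> \int[mu]_(u in `]s, t[) d u = 0.
  move=> st stU; have := plateau_limit mU st stU igh.
  rewrite (_ : \int[mu]_(u in `]s, t[) d u = \int[mu]_(u in `]s, t[) (g u - h u)); last first.
    by apply: eq_Rintegral => u /set_mem /stU Uu; rewrite /d patchE mem_set.
  move=> H; apply: (cvg_unique _ H) => //.
  apply: cvg_near_cst; near=> n.
  have n0 : 0 < n%:R :> R by near: n; exact: nbhs_infty_gtr.
  have n4 : 4 <= n%:R * (t - s).
    rewrite -ler_pdivrMr ?subr_gt0 //; near: n; exact: nbhs_infty_ger.
  have tf := test_plateau stU n4 n0.
  transitivity (\int[mu]_(u in U) (g u * plateau s t n%:R u) -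
                \int[mu]_(u in U) (h u * plateau s t n%:R u)).
    rewrite -RintegralB //; try exact: integrable_plateauM.
    by apply: eq_Rintegral => u _; ring.
  by have := fg _ tf; rewrite (fh _ tf) => /oppr_inj ->; rewrite subrr.
have idS y : mu.-integrable `]-oo, y] (EFin \o d) by exact: integrableS idT.
have := @FTC1Ny _ d idS (integrable_locally mU igh).
apply: filterS; first exact: (ae_filter_ringOfSetsType mu).
move=> x [_ dx] Ux; move: dx; rewrite (Rintegral_oo0_derive oU Ux) //.
by rewrite /d patchE mem_set // => /esym/eqP; rewrite subr_eq0 /= => /eqP ->.
Unshelve. all: by end_near. Qed.

Lemma L2normE D f :
  L2norm D f = ((\int[mu]_(x in D) (f x ^+ 2)%:E) `^ 2^-1)%E.
Proof. exact: Lnorm2_restrict. Qed.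

Lemma L2P D f : measurable D ->
  L2 D f <-> measurable_fun D f /\ mu.-integrable D (EFin \o (fun x => f x ^+ 2)).
Proof. by move=> mD; exact: (@Lfun2_restrictP _ _ _ mu). Qed.

Lemma L2norm_sqrt D f : measurable D ->
  mu.-integrable D (EFin \o (fun x => f x ^+ 2)) ->
  L2norm D f = (Num.sqrt (\int[mu]_(x in D) (f x ^+ 2)))%:E.
Proof.
move=> mD if2; rewrite L2normE -(@fineK _ (\int[mu]_(x in D) _)%E); last first.
  exact: integrable_fin_num if2.
by rewrite poweR_EFin powR12_sqrt // Rintegral_ge0 // => x _; exact: sqr_ge0.
Qed.

Lemma L2_integrable D f : measurable D -> (mu D < +oo)%E -> L2 D f ->
  mu.-integrable D (EFin \o f).
Proof.
move=> mD Dfin /(L2P _ mD)[mf if2].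
have i1 : mu.-integrable D (EFin \o (fun=> 1 : R)).
  apply: (@measurable_bounded_integrable _ _ _ mu) => //.
  by exists 1; split=> // M M1 x _ /=; rewrite normr1 ltW.
have i12 : mu.-integrable D (EFin \o (fun x => 1 + f x ^+ 2)) by exact: integrable_EFinD.
apply: (le_integrable _ _ _ i12) => //; first exact/measurable_EFinP.
move=> x Dx /=; rewrite lee_fin [leRHS]ger0_norm ?addr_ge0 ?sqr_ge0 //.
by rewrite -real_normK ?num_real //; have := normr_ge0 (f x); nra.
Qed.

Lemma ae_eq_L2norm D f g : measurable D -> measurable_fun D f -> measurable_fun D g ->
  ae_eq mu D (EFin \o f) (EFin \o g) -> L2norm D f = L2norm D g.
Proof.
move=> mD mf mg fg; rewrite !L2normE; congr (_ `^ _)%E; apply: ae_eq_integral => //.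
- by apply/measurable_EFinP; exact: measurable_funX.
- by apply/measurable_EFinP; exact: measurable_funX.
- move: fg; apply: filterS => x fgx Dx; by have [->] := fgx Dx.
Qed.

End WeakDerivativeUniqueness.

(** * Weak derivatives of locally absolutely continuous functions *)

Section LocallyPrimitive.
Context {R : realType}.
Implicit Types (a b x y z : R) (f g h : R -> R) (U D : set R).
Local Notation mu := (@lebesgue_measure R).

Lemma test_function_off U phi z : test_function U phi -> ~ U z ->
  exists2 d, 0 < d & forall t, `|t - z| < d -> phi t = 0 /\ derive1 phi t = 0.
Proof.
move=> [_ _ _ supU] Uz.
have oC : open (~` closure [set x | phi x != 0]).
  by rewrite openC; exact: closed_closure.
have off t : (~` closure [set x | phi x != 0]) t -> phi t = 0.
  by apply: contra_notP => /eqP phit; exact: subset_closure.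
have [d /= d0 dP] : \forall t \near z, (~` closure [set x | phi x != 0]) t.
  by apply: open_nbhs_nbhs; split => // /supU.
exists d => // t tz; have Ct : (~` closure [set x | phi x != 0]) t.
  by apply: dP; rewrite /= distrC.
split; first exact: off.
rewrite derive1E; transitivity ('D_1 (cst 0) t : R); last exact: derive_cst.
apply: near_eq_derive; near=> s; apply: off; near: s; exact: open_nbhs_nbhs.
Unshelve. all: by end_near. Qed.

Lemma continuous_test U phi : test_function U phi -> continuous phi.
Proof.
by move=> [dphi _ _ _] x; exact/differentiable_continuous/derivable1_diffP.
Qed.

(** Integration by parts for functions that are only locally absolutely
    continuous on [U]: near a point of [U] the product with the test function
    has an integral, near any other point the test function vanishes, and
    Cousin's lemma joins the two cases. *)
Lemma locally_primitive_weak_derivative U a b f h : open U -> U `<=` `]a, b[ ->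
  mu.-integrable U (EFin \o f) -> mu.-integrable U (EFin \o h) ->
  (forall x, U x -> exists2 d, 0 < d & primitive (x - d) (x + d) f h) ->
  is_weak_derivative U f h.
Proof.
move=> oU Uab if_ ih fh phi tphi.
have mU : measurable U by exact: open_measurable.
have [ab|ba] := leP a b; last first.
  have -> : U = set0 by rewrite -subset0 => x /Uab; rewrite /= in_itv /=; move: ba; clear; lra.
  by rewrite !Rintegral_set0 oppr0.
have cphi := continuous_test tphi.
have cdphi : continuous (derive1 phi) by case: tphi.
pose f0 := f \_ U; pose h0 := h \_ U.
have if0 : mu.-integrable `[a, b] (EFin \o f0).
  have H : mu.-integrable [set: R] (EFin \o f0) by apply: (@integrable_restrictT _ _ _ mu).
  by apply: integrableS H.
have ih0 : mu.-integrable `[a, b] (EFin \o h0).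
  have H : mu.-integrable [set: R] (EFin \o h0) by apply: (@integrable_restrictT _ _ _ mu).
  by apply: integrableS H.
have i1 : mu.-integrable `[a, b] (EFin \o (fun t => derive1 phi t * f0 t)).
  by apply: integrable_continuousM => //; exact: continuous_subspaceT.
have i2 : mu.-integrable `[a, b] (EFin \o (fun t => phi t * h0 t)).
  by apply: integrable_continuousM => //; exact: continuous_subspaceT.
pose G t := derive1 phi t * f0 t + phi t * h0 t.
have iG : mu.-integrable `[a, b] (EFin \o G) by exact: integrable_EFinD.
pose P s t := \int[mu]_(u in `[s, t]) G u = f t * phi t - f s * phi s.
have Pab : P a b.
  apply: cousin => //.
    move=> s t u as_ st tu ub; rewrite /P => Pst Ptu.
    rewrite (@Rintegral_segment_split _ G s t u) //.
      by rewrite Pst Ptu; ring.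
    exact: integrable_subsegment iG.
  move=> z zab; have [Uz|Uz] := pselect (U z).
    have [d d0 pd] := fh z Uz.
    have [r /= r0 rU] : \forall y \near z, U y by exact: open_nbhs_nbhs.
    exists (Num.min d r); first by rewrite lt_min d0.
    move=> s t as_ sz zt tb; rewrite ltrBlDl -ltrBlDr => zs.
    rewrite -ltrBlDl => tz.
    have [zsd zsr] : z - s < d /\ z - s < r by apply/andP; rewrite -lt_min.
    have [tzd tzr] : t - z < d /\ t - z < r by apply/andP; rewrite -lt_min.
    have [_ pm] := primitiveM pd (@primitive_test _ _ _ (z - d) (z + d) tphi).
    rewrite /P pm; [|by move: zsd; clear; lra|exact: le_trans zt|by move: tzd; clear; lra].
    apply: eq_Rintegral => u /set_mem; rewrite /= in_itv /= => /andP[su ut].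
    have Uu : U u by apply: rU; rewrite /= ltr_norml; move: su ut zsr tzr; clear; lra.
    by rewrite /G /f0 /h0 !patchE mem_set //; ring.
  have [d d0 dP] := test_function_off tphi Uz.
  exists d => // s t as_ sz zt tb zs tz.
  have phi0 u : s <= u -> u <= t -> phi u = 0 /\ derive1 phi u = 0.
    by move=> su ut; apply: dP; rewrite ltr_norml; move: su ut zs tz; clear; lra.
  have st := le_trans sz zt.
  rewrite /P (phi0 s _ st).1 // (phi0 t st _).1 // !mulr0 subr0.
  transitivity (\int[mu]_(u in `[s, t]) (0 : R)); last by rewrite Rintegral_cst // mul0r.
  apply: eq_Rintegral => u /set_mem; rewrite /= in_itv /= => /andP[su ut].
  by have [p0 dp0] := phi0 u su ut; rewrite /G p0 dp0 !mul0r addr0.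
have nUa : ~ U a by move=> /Uab; rewrite /= in_itv /= ltxx.
have nUb : ~ U b by move=> /Uab; rewrite /= in_itv /= ltxx andbF.
have phia : phi a = 0.
  by have [d d0 /(_ a)] := test_function_off tphi nUa; rewrite subrr normr0 => /(_ d0) [].
have phib : phi b = 0.
  by have [d d0 /(_ b)] := test_function_off tphi nUb; rewrite subrr normr0 => /(_ d0) [].
move: Pab; rewrite /P phia phib !mulr0 subr0 RintegralD // => /eqP; rewrite addr_eq0 => /eqP.
have Uabc : U `<=` `[a, b] by move=> x /Uab; exact: subset_itv_oo_cc.
have toU (k w : R -> R) : \int[mu]_(t in `[a, b]) (k t * (w \_ U) t) =
    \int[mu]_(t in U) (w t * k t).
  rewrite -[in RHS](setIidr Uabc) Rintegral_mkcondr; apply: eq_Rintegral => t _.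
  by rewrite !patchE; case: ifP => _; rewrite ?mulr0 // mulrC.
by rewrite /f0 /h0 !toU.
Qed.

Lemma bounded_measure_fin U a b : measurable U -> U `<=` `[a, b] -> (mu U < +oo)%E.
Proof.
move=> mU Uab; apply: (@le_lt_trans _ _ (mu `[a, b])); first by apply: le_measure => //; rewrite inE.
have [ab|ba] := leP a b; first by rewrite lebesgue_measure_segment ?ltry.
by rewrite set_itv_ge ?bnd_simp -?ltNge // measure0.
Qed.

Lemma bounded_L2 U a b f (M : R) : measurable U -> U `<=` `[a, b] -> measurable_fun U f ->
  (forall x, U x -> `|f x| <= M) -> L2 U f.
Proof.
move=> mU Uab mf fM; apply/L2P => //; split => //.
apply: (@measurable_bounded_integrable _ _ _ mu) => //.
- exact: bounded_measure_fin Uab.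
- exact: measurable_funX.
- exists (M ^+ 2); split=> [|N MN x Ux /=]; first exact: num_real.
  rewrite normrX (le_trans _ (ltW MN)) // ler_pXn2r ?nnegrE ?fM //.
  by rewrite (le_trans _ (fM _ Ux)).
Qed.

(** By uniqueness, the norm can be computed with any square integrable weak
    derivative. *)
Lemma H1normE U a b f h : open U -> U `<=` `[a, b] -> L2 U h ->
  is_weak_derivative U f h ->
  H1norm U f = (L2norm U f + L2norm U h)%E.
Proof.
move=> oU Uab Lh fh; rewrite /H1norm; congr (_ + _)%E.
have mU : measurable U by exact: open_measurable.
have Ufin := bounded_measure_fin mU Uab.
have [Lw fw] : [set g | L2 U g /\ is_weak_derivative U f g] (weak_derivative U f).
  by rewrite /weak_derivative; apply: xgetPex; exists h.
apply: ae_eq_L2norm => //.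
- by case: ((L2P _ mU).1 Lw).
- by case: ((L2P _ mU).1 Lh).
- by apply: weak_derivative_unique fw fh => //; exact: L2_integrable.
Qed.

Lemma locally_primitive_continuous f h x :
  (exists2 d, 0 < d & primitive (x - d) (x + d) f h) -> {for x, continuous f}.
Proof.
move=> [d d0 /primitive_continuous cf].
have xd : x - d < x + d by move: d0; clear; lra.
apply: (within_continuous_continuous xd cf).
by rewrite in_itv /=; move: d0; clear; lra.
Qed.

End LocallyPrimitive.

(** * Energy estimates for a single map *)

Section EnergyBounds.
Context {R : realType}.
Local Notation mu := (@lebesgue_measure R).

Implicit Types (a b s t x : R) (f g k h : R -> R).

Lemma measurable_segment a b f : {within `[a, b], continuous f} ->
  measurable_fun `[a, b] f.
Proof. by move=> cf; exact: subspace_continuous_measurable_fun. Qed.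

Lemma integrable_dominated a b g k : measurable_fun `[a, b] g ->
  mu.-integrable `[a, b] (EFin \o k) ->
  (forall t, a <= t <= b -> `|g t| <= k t) -> mu.-integrable `[a, b] (EFin \o g).
Proof.
move=> mg ik gk; apply: (le_integrable _ _ _ ik) => //; first exact/measurable_EFinP.
move=> t /=; rewrite in_itv /= => tab; rewrite lee_fin.
by rewrite (le_trans (gk t tab)) // ler_norm.
Qed.

Lemma Rintegral_subsegment_le a b s t k : a <= s -> s <= t -> t <= b ->
  mu.-integrable `[a, b] (EFin \o k) -> (forall u, a <= u <= b -> 0 <= k u) ->
  \int[mu]_(u in `[s, t]) k u <= \int[mu]_(u in `[a, b]) k u.
Proof.
move=> as_ st tb ik k0.
have ge0 x y : a <= x -> y <= b -> 0 <= \int[mu]_(u in `[x, y]) k u.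
  move=> ax yb; apply: Rintegral_ge0 => u; rewrite /= in_itv /= => /andP[xu uy].
  by rewrite k0 // (le_trans ax) // (le_trans uy).
rewrite (@Rintegral_segment_split _ k a s b) //; last exact: le_trans tb.
rewrite (@Rintegral_segment_split _ k s t b) //; last exact: integrable_subsegment ik.
have := ge0 a s (lexx _) (le_trans st tb).
by have := ge0 t b (le_trans as_ st) (lexx _); clear; lra.
Qed.

Definition sqnorm (u1 u2 : R -> R) (t : R) : R := u1 t ^+ 2 + u2 t ^+ 2.

(** The angular momentum [rho^2 theta'] of [u = rho exp(i theta)]. *)
Definition current (u1 u2 d1 d2 : R -> R) (t : R) : R := u1 t * d2 t - u2 t * d1 t.

Definition density (L kap eps : R) (u1 u2 d1 d2 : R -> R) (t : R) : R :=
  eps / 2 * (d1 t ^+ 2 + d2 t ^+ 2)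
  + (4 * eps)^-1 * (sqnorm u1 u2 t - 1) ^+ 2
  + L / 2 * (current u1 u2 d1 d2 t - kap) ^+ 2.

(** All that the estimates use of a map [u1 + i u2] with weak derivative
    [d1 + i d2]; in this form it is stable under a rotation of the plane. *)
Record energy_bounded (L kap eps C0 : R) (u1 u2 d1 d2 : R -> R) : Prop := {
  eb_L : 0 < L;
  eb_eps : 0 < eps;
  eb_p1 : primitive 0 1 u1 d1;
  eb_p2 : primitive 0 1 u2 d2;
  eb_start : sqnorm u1 u2 0 = 1;
  eb_int : mu.-integrable `[0, 1] (EFin \o density L kap eps u1 u2 d1 d2);
  eb_le : \int[mu]_(t in `[0, 1]) density L kap eps u1 u2 d1 d2 t <= C0 }.

Lemma primitive_measurable a b (f h : R -> R) : primitive a b f h ->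
  measurable_fun `[a, b] f /\ measurable_fun `[a, b] h.
Proof.
move=> pf; split; first exact: measurable_segment (primitive_continuous pf).
by case: pf => /integrableP[/measurable_EFinP].
Qed.

Lemma measurable_current a b u1 u2 d1 d2 : primitive a b u1 d1 -> primitive a b u2 d2 ->
  measurable_fun `[a, b] (current u1 u2 d1 d2).
Proof.
move=> /primitive_measurable[m1 n1] /primitive_measurable[m2 n2].
by apply: measurable_funB; exact: measurable_funM.
Qed.

Lemma primitive_sqnorm a b u1 u2 d1 d2 : primitive a b u1 d1 -> primitive a b u2 d2 ->
  primitive a b (sqnorm u1 u2) (fun t => 2 * (u1 t * d1 t + u2 t * d2 t)).
Proof.
move=> p1 p2.
by apply: eq_primitive (primitiveD (primitive_sqr p1) (primitive_sqr p2)) => t _ //; ring.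
Qed.

Lemma primitive_potential a b u1 u2 d1 d2 : primitive a b u1 d1 -> primitive a b u2 d2 ->
  primitive a b (fun t => (sqnorm u1 u2 t - 1) ^+ 2)
  (fun t => 2 * (sqnorm u1 u2 t - 1) * (2 * (u1 t * d1 t + u2 t * d2 t))).
Proof.
move=> p1 p2; have pr := primitiveB (primitive_sqnorm p1 p2) (primitive_cst a b 1).
by apply: eq_primitive (primitive_sqr pr) => t _ //; rewrite subr0.
Qed.

Lemma sqnorm_ge0 u1 u2 t : 0 <= sqnorm u1 u2 t.
Proof. by rewrite addr_ge0 ?sqr_ge0. Qed.

Lemma component_le (M x y : R) : 0 <= M -> x ^+ 2 + y ^+ 2 <= M ^+ 2 -> `|x| <= M.
Proof.
move=> M0 H; rewrite -(@ler_pXn2r _ 2) ?nnegrE // real_normK ?num_real //.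
by have := sqr_ge0 y; move: H; clear; lra.
Qed.

Lemma density_parts L kap eps u1 u2 d1 d2 t : 0 < L -> 0 < eps ->
  [/\ 0 <= eps / 2 * (d1 t ^+ 2 + d2 t ^+ 2),
      0 <= (4 * eps)^-1 * (sqnorm u1 u2 t - 1) ^+ 2 &
      0 <= L / 2 * (current u1 u2 d1 d2 t - kap) ^+ 2].
Proof.
move=> L0 eps0; split; rewrite mulr_ge0 ?addr_ge0 ?sqr_ge0 //.
- by rewrite divr_ge0 // ltW.
- by rewrite invr_ge0 mulr_ge0 // ltW.
- by rewrite divr_ge0 // ltW.
Qed.

Lemma density_ge0 L kap eps u1 u2 d1 d2 t : 0 < L -> 0 < eps ->
  0 <= density L kap eps u1 u2 d1 d2 t.
Proof.
move=> L0 eps0; have [A B C] := density_parts kap u1 u2 d1 d2 t L0 eps0.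
by rewrite /density; move: A B C; clear; lra.
Qed.

Lemma potential_le L kap eps u1 u2 d1 d2 t : 0 < L -> 0 < eps ->
  (sqnorm u1 u2 t - 1) ^+ 2 <= 4 * eps * density L kap eps u1 u2 d1 d2 t.
Proof.
move=> L0 eps0; have [A B C] := density_parts kap u1 u2 d1 d2 t L0 eps0.
by rewrite -ler_pdivrMl ?mulr_gt0 // /density; move: A C; clear; lra.
Qed.

Lemma twist_le L kap eps u1 u2 d1 d2 t : 0 < L -> 0 < eps ->
  (current u1 u2 d1 d2 t - kap) ^+ 2 <= 2 / L * density L kap eps u1 u2 d1 d2 t.
Proof.
move=> L0 eps0; have [A B C] := density_parts kap u1 u2 d1 d2 t L0 eps0.
by rewrite -ler_pdivrMl ?divr_gt0 // /density invf_div; move: A B; clear; lra.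
Qed.

(** Young's inequality absorbs the factor [eps] of the gradient term against
    the factor [1 / eps] of the potential. *)
Lemma young_density L kap eps u1 u2 d1 d2 t (d : R) : 0 < L -> 0 < eps ->
  d ^+ 2 <= d1 t ^+ 2 + d2 t ^+ 2 ->
  `|(sqnorm u1 u2 t - 1) * d| <= 2 * density L kap eps u1 u2 d1 d2 t.
Proof.
move=> L0 eps0 dle; have [_ _ A2] := density_parts kap u1 u2 d1 d2 t L0 eps0.
have A1 : eps / 2 * d ^+ 2 <= eps / 2 * (d1 t ^+ 2 + d2 t ^+ 2).
  by rewrite ler_wpM2l // divr_ge0 // ltW.
have Y : `|(sqnorm u1 u2 t - 1) * d| <=
    2 * (eps / 2 * d ^+ 2 + (4 * eps)^-1 * (sqnorm u1 u2 t - 1) ^+ 2).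
  rewrite normrM -[d ^+ 2]real_normK ?num_real //.
  rewrite -[(sqnorm u1 u2 t - 1) ^+ 2]real_normK ?num_real //.
  set x := `|d|; set y := `|_ - 1|; rewrite -subr_ge0.
  rewrite (_ : _ - _ = eps * ((x - y / (2 * eps)) ^+ 2 + (y / (2 * eps)) ^+ 2)).
    by rewrite mulr_ge0 ?addr_ge0 ?sqr_ge0 // ltW.
  by field; rewrite gt_eqF.
by rewrite /density; move: A1 A2 Y; clear; lra.
Qed.

Lemma energy_bounded_ge0 L kap eps C0 u1 u2 d1 d2 :
  energy_bounded L kap eps C0 u1 u2 d1 d2 -> 0 <= C0.
Proof.
case=> L0 eps0 _ _ _ _; apply: le_trans; apply: Rintegral_ge0 => t _.
exact: density_ge0.
Qed.

Lemma Rintegral_density_le L kap eps C0 u1 u2 d1 d2 s t :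
  energy_bounded L kap eps C0 u1 u2 d1 d2 -> 0 <= s -> s <= t -> t <= 1 ->
  \int[mu]_(u in `[s, t]) density L kap eps u1 u2 d1 d2 u <= C0.
Proof.
case=> L0 eps0 _ _ _ ie eC s0 st t1; apply: le_trans eC.
by apply: Rintegral_subsegment_le => // u _; exact: density_ge0.
Qed.

(** The derivative of the potential is [4 (|u|^2 - 1) (u . u')], to which
    Young's inequality applies when [|u|] is bounded. *)
Lemma oscillation_potential L kap eps C0 u1 u2 d1 d2 (M : R) :
  energy_bounded L kap eps C0 u1 u2 d1 d2 -> 0 <= M ->
  (forall t, 0 <= t <= 1 -> sqnorm u1 u2 t <= M ^+ 2) ->
  forall s t, 0 <= s -> s <= t -> t <= 1 ->
  `|(sqnorm u1 u2 t - 1) ^+ 2 - (sqnorm u1 u2 s - 1) ^+ 2| <=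
    16 * M * \int[mu]_(u in `[s, t]) density L kap eps u1 u2 d1 d2 u.
Proof.
case=> L0 eps0 p1 p2 _ idens _ M0 rM s t s0 st t1.
have [iT TE] := primitive_potential p1 p2.
have ist : mu.-integrable `[s, t] (EFin \o density L kap eps u1 u2 d1 d2).
  exact: integrable_subsegment idens.
rewrite TE // -RintegralZl //; apply: ler_norm_Rintegral => //.
- exact: integrable_subsegment iT.
- exact: integrable_EFinZ.
move=> u; rewrite /= in_itv /= => /andP[su ut].
have /rM ruM : 0 <= u <= 1 by rewrite (le_trans s0 su) (le_trans ut t1).
have v1 : `|u1 u| <= M by apply: component_le ruM.
have v2 : `|u2 u| <= M by apply: (@component_le _ _ (u1 u)) => //; rewrite addrC.
set r := sqnorm u1 u2 u; set e := density _ _ _ _ _ _ _ _.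
have y1 : `|(r - 1) * d1 u| <= 2 * e by apply: young_density; rewrite // lerDl sqr_ge0.
have y2 : `|(r - 1) * d2 u| <= 2 * e by apply: young_density; rewrite // lerDr sqr_ge0.
rewrite (_ : 2 * _ * _ = 4 * (u1 u * ((r - 1) * d1 u) + u2 u * ((r - 1) * d2 u))); last by ring.
rewrite normrM ger0_norm //.
have := ler_normD (u1 u * ((r - 1) * d1 u)) (u2 u * ((r - 1) * d2 u)).
rewrite !(normrM (u1 u)) !(normrM (u2 u)).
have := ler_pM (normr_ge0 _) (normr_ge0 _) v1 y1.
have := ler_pM (normr_ge0 _) (normr_ge0 _) v2 y2.
by clear; lra.
Qed.

(** At a maximum point of the modulus the potential is at most a multiple of
    the maximum, although it grows like its fourth power. *)
Lemma sup_bound L kap eps C0 u1 u2 d1 d2 t :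
  energy_bounded L kap eps C0 u1 u2 d1 d2 -> 0 <= t <= 1 ->
  sqnorm u1 u2 t <= (2 + 64 * C0) ^+ 2.
Proof.
move=> EB; have C00 := energy_bounded_ge0 EB; have [L0 eps0 p1 p2 r0 _ _] := EB.
have cr := primitive_continuous (primitive_sqnorm p1 p2).
have [m m01 rm] := EVT_max (@ler01 R) cr.
move: (m01); rewrite in_itv /= => /andP[m0 m1] t01.
apply: (@le_trans _ _ (sqnorm u1 u2 m)); first by apply: rm; rewrite in_itv.
set M := Num.sqrt (sqnorm u1 u2 m); have M0 : 0 <= M by exact: sqrtr_ge0.
have M2 : M ^+ 2 = sqnorm u1 u2 m by rewrite sqr_sqrtr // sqnorm_ge0.
have rM s : 0 <= s <= 1 -> sqnorm u1 u2 s <= M ^+ 2.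
  by move=> s01; rewrite M2; apply: rm; rewrite in_itv.
have := oscillation_potential EB M0 rM (lexx 0) m0 m1.
rewrite r0 subrr expr0n /= subr0 -M2 ger0_norm ?sqr_ge0 // => H.
have I := Rintegral_density_le EB (lexx 0) m0 m1.
have {}H : (M ^+ 2 - 1) ^+ 2 <= 16 * M * C0.
  by apply: le_trans H _; rewrite ler_wpM2l // mulr_ge0.
rewrite ler_pXn2r ?nnegrE //; last by move: C00; clear; lra.
rewrite leNgt; apply/negP => MC.
have M2_ : 2 < M by move: MC C00; clear; lra.
have MC' : 64 * C0 < M by move: MC C00; clear; lra.
have Q : M ^+ 2 / 2 <= M ^+ 2 - 1 by move: M2_; clear; nra.
have Q2 : (M ^+ 2 / 2) ^+ 2 <= 16 * M * C0.
  apply: le_trans H; rewrite ler_pXn2r ?nnegrE ?divr_ge0 ?sqr_ge0 //.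
  by move: M2_; clear; nra.
have Q3 : M * M ^+ 3 <= M * (64 * C0) by move: Q2; rewrite !exprS expr0; clear; lra.
have Q4 : M ^+ 3 <= 64 * C0 by rewrite -(@ler_pM2l _ M) //; move: M2_; clear; lra.
have Q5 : M <= M ^+ 3.
  by rewrite exprS -[leLHS]mulr1 ler_pM2l; [move: M2_; clear; nra | move: M2_; clear; lra].
by move: Q4 Q5 MC'; clear; lra.
Qed.

(** A point where the modulus is small costs a fixed amount of energy in any
    interval that is long compared with [eps]: the potential has to come back
    near its minimum inside the interval. *)
Lemma bad_point_energy L kap eps C0 u1 u2 d1 d2 a b x :
  energy_bounded L kap eps C0 u1 u2 d1 d2 -> 0 <= a -> b <= 1 ->
  16 * eps * C0 < b - a -> a <= x <= b -> sqnorm u1 u2 x <= 1 / 4 ->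
  1 <= 64 * (2 + 64 * C0) * \int[mu]_(u in `[a, b]) density L kap eps u1 u2 d1 d2 u.
Proof.
move=> EB a0 b1 ab /andP[ax xb] rx; have C00 := energy_bounded_ge0 EB.
have [L0 eps0 p1 p2 _ ie _] := EB.
have leab := le_trans ax xb.
have iab : mu.-integrable `[a, b] (EFin \o density L kap eps u1 u2 d1 d2).
  exact: integrable_subsegment ie.
have [y /andP[ay yb] ry] : exists2 y, a <= y <= b & (sqnorm u1 u2 y - 1) ^+ 2 <= 1 / 4.
  apply: contrapT => nex; have : (16 * eps)^-1 * (b - a) <= C0.
    apply: le_trans (Rintegral_density_le EB a0 leab b1).
    rewrite -Rintegral_segment_cst //; apply: le_Rintegral => //.
      apply: continuous_compact_integrable; first exact: segment_compact.
      by apply: continuous_subspaceT => z; exact: cvg_cst.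
    move=> t; rewrite /= in_itv /= => tab.
    have : 1 / 4 < (sqnorm u1 u2 t - 1) ^+ 2.
      by rewrite ltNge; apply/negP => H; apply: nex; exists t.
    have := potential_le kap u1 u2 d1 d2 t L0 eps0; set e := density _ _ _ _ _ _ _ _.
    move=> H1 H2; rewrite -[leLHS]mulr1 ler_pdivrMl ?mulr_gt0 //.
    by move: H1 H2; clear; lra.
  by rewrite ler_pdivrMl ?mulr_gt0 // leNgt ab.
pose I s t := \int[mu]_(u in `[s, t]) density L kap eps u1 u2 d1 d2 u.
have sub s t : a <= s -> s <= t -> t <= b -> I s t <= I a b.
  move=> as_ st tb; apply: Rintegral_subsegment_le => // u _; exact: density_ge0.
have M0 : 0 <= 2 + 64 * C0 by move: C00; clear; lra.
have Tx : 9 / 16 <= (sqnorm u1 u2 x - 1) ^+ 2.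
  by have := sqnorm_ge0 u1 u2 x; move: rx; clear; nra.
have osc := oscillation_potential EB M0 (fun t => @sup_bound _ _ _ _ _ _ _ _ t EB).
have key : 5 / 16 <= 16 * (2 + 64 * C0) * I a b.
  have [xy|/ltW yx] := leP x y.
    have := osc x y (le_trans a0 ax) xy (le_trans yb b1); rewrite distrC.
    move=> /(le_trans (ler_norm _)) H.
    have : 16 * (2 + 64 * C0) * I x y <= 16 * (2 + 64 * C0) * I a b.
      by rewrite ler_wpM2l ?mulr_ge0 // sub.
    by rewrite /I in H *; move: H Tx ry; clear; lra.
  have := osc y x (le_trans a0 ay) yx (le_trans xb b1).
  move=> /(le_trans (ler_norm _)) H.
  have : 16 * (2 + 64 * C0) * I y x <= 16 * (2 + 64 * C0) * I a b.
    by rewrite ler_wpM2l ?mulr_ge0 // sub.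
  by rewrite /I in H *; move: H Tx ry; clear; lra.
by move: key; rewrite /I; clear; lra.
Qed.

End EnergyBounds.

(** * Means over intervals, and the speed of the phase *)

Section MeansAndPhaseSpeed.
Context {R : realType}.
Local Notation mu := (@lebesgue_measure R).
Implicit Types (a b s t x : R) (f g k h : R -> R).

Lemma integrable_segment_cst a b (c : R) : mu.-integrable `[a, b] (EFin \o (fun=> c)).
Proof.
apply: continuous_compact_integrable; first exact: segment_compact.
by apply: continuous_subspaceT => z; exact: cvg_cst.
Qed.

Lemma integrable_continuous a b f : {within `[a, b], continuous f} ->
  mu.-integrable `[a, b] (EFin \o f).
Proof.
by move=> cf; apply: continuous_compact_integrable => //; exact: segment_compact.
Qed.

(** Carries estimates of the first component over to the second. *)
Lemma energy_bounded_rotate L kap eps C0 u1 u2 d1 d2 :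
  energy_bounded L kap eps C0 u1 u2 d1 d2 ->
  energy_bounded L kap eps C0 u2 (fun t => -1 * u1 t) d2 (fun t => -1 * d1 t).
Proof.
have Er : sqnorm u2 (fun t => -1 * u1 t) = sqnorm u1 u2.
  by apply/funext => t; rewrite /sqnorm; ring.
have Ee : density L kap eps u2 (fun t => -1 * u1 t) d2 (fun t => -1 * d1 t) =
    density L kap eps u1 u2 d1 d2.
  by apply/funext => t; rewrite /density Er /current; ring.
case=> L0 eps0 p1 p2 r0 ie eC; split => //; rewrite ?Er ?Ee //.
exact: primitiveZ.
Qed.

(** The identity [i j u = |u|^2 u' - (|u|^2)' u / 2] writes [kap u] as a
    derivative of a bounded function plus terms controlled by the energy, so
    that the mean of [u] over any interval is [O(1 / kap)]. *)
Lemma segment_mean_bound L kap eps C0 u1 u2 d1 d2 (M := 2 + 64 * C0) s t :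
  energy_bounded L kap eps C0 u1 u2 d1 d2 -> 0 <= s -> s <= t -> t <= 1 ->
  `|kap * \int[mu]_(x in `[s, t]) u1 x| <=
    3 * M + M * (M ^+ 2 + 1) + (3 + 2 * M / L) * C0.
Proof.
move=> EB s0 st t1; have C00 := energy_bounded_ge0 EB; have [L0 eps0 p1 p2 _ ie _] := EB.
have M0 : 0 <= M by rewrite /M; move: C00; clear; lra.
have rM x : 0 <= x <= 1 -> sqnorm u1 u2 x <= M ^+ 2 by exact: sup_bound EB.
have v1 x : 0 <= x <= 1 -> `|u1 x| <= M by move=> /rM; exact: component_le.
have v2 x : 0 <= x <= 1 -> `|u2 x| <= M.
  by move=> /rM; rewrite /sqnorm addrC; exact: component_le.
pose r1 x := sqnorm u1 u2 x - 1.
have pr1 : primitive 0 1 r1 (fun x => 2 * (u1 x * d1 x + u2 x * d2 x) - 0).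
  exact: primitiveB (primitive_sqnorm p1 p2) (primitive_cst 0 1 1).
(* [q] collects the exact derivatives in the identity; what then remains of
   [kap u1] is bounded pointwise by the density. *)
pose q x := u2 x - 1 / 2 * (r1 x * u2 x).
pose dq x := d2 x - 1 / 2 * (r1 x * d2 x + u2 x * (2 * (u1 x * d1 x + u2 x * d2 x) - 0)).
have pq : primitive 0 1 q dq by apply: primitiveB => //; apply: primitiveZ; exact: primitiveM.
have [iq qE] := pq.
have iu1 : mu.-integrable `[0, 1] (EFin \o u1).
  exact/integrable_continuous/primitive_continuous/p1.
have sub k : mu.-integrable `[0, 1] (EFin \o k) -> mu.-integrable `[s, t] (EFin \o k).
  exact: integrable_subsegment.
have ik1 : mu.-integrable `[s, t] (EFin \o (fun x => kap * u1 x)).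
  by apply: integrable_EFinZ => //; exact: sub.
rewrite -RintegralZl //; last exact: sub.
have -> : \int[mu]_(x in `[s, t]) (kap * u1 x) =
    q t - q s + \int[mu]_(x in `[s, t]) (kap * u1 x - dq x).
  by rewrite RintegralB //; [rewrite qE //; ring | exact: sub].
have qM x : 0 <= x <= 1 -> `|q x| <= M + 1 / 2 * ((M ^+ 2 + 1) * M).
  move=> x01; apply: le_trans (ler_normB _ _) _; apply: lerD; first exact: v2.
  rewrite normrM ger0_norm // ler_wpM2l // normrM ler_pM // ?v2 //.
  have := rM _ x01; have := sqnorm_ge0 u1 u2 x; rewrite /r1 ler_norml; clear; lra.
have s01 : 0 <= s <= 1 by rewrite s0 (le_trans st).
have t01 : 0 <= t <= 1 by rewrite t1 (le_trans s0).
pose e := density L kap eps u1 u2 d1 d2.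
have ist : mu.-integrable `[s, t] (EFin \o e) by exact: sub.
have main : `|\int[mu]_(x in `[s, t]) (kap * u1 x - dq x)| <=
    M * 1 + (3 + 2 * M / L) * C0.
  apply: (@le_trans _ _ (\int[mu]_(x in `[s, t]) (M * 1 + (3 + 2 * M / L) * e x))).
    apply: ler_norm_Rintegral => //.
    - by apply: integrable_EFinB => //; exact: sub.
    - by apply: integrable_EFinD; [|exact: integrable_segment_cst | exact: integrable_EFinZ].
    move=> x; rewrite /= in_itv /= => /andP[sx xt].
    have x01 : 0 <= x <= 1 by rewrite (le_trans s0) // (le_trans xt).
    rewrite (_ : _ - _ = 3 / 2 * (r1 x * d2 x) -
      (current u1 u2 d1 d2 x - kap) * u1 x); last first.
      by rewrite /dq /r1 /sqnorm /current; field.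
    have n32 : `|3 / 2 : R| = 3 / 2 by rewrite gtr0_norm // divr_gt0.
    apply: le_trans (ler_normB _ _) _.
    rewrite (normrM (3 / 2)) (normrM (r1 x)) (normrM (_ - kap)) n32.
    have := @young_density _ L kap eps u1 u2 d1 d2 x (d2 x) L0 eps0.
    rewrite lerDr sqr_ge0 normrM => /(_ isT) Y.
    have := @twist_le _ L kap eps u1 u2 d1 d2 x L0 eps0.
    set w := _ - kap; rewrite -/(e x) => tw.
    have : `|w| * `|u1 x| <= (1 + w ^+ 2) * M.
      apply: ler_pM => //; last exact: v1.
      rewrite -[w ^+ 2]real_normK ?num_real //; have := normr_ge0 w.
      by set z := `|w|; clear; nra.
    have : (1 + w ^+ 2) * M <= (1 + 2 / L * e x) * M by rewrite ler_wpM2r // lerD2l.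
    by move: Y; rewrite -/(e x) -/(r1 x); set X := `|r1 x| * _; clear; lra.
  rewrite RintegralD //; [|exact: integrable_segment_cst|exact: integrable_EFinZ].
  rewrite Rintegral_segment_cst // RintegralZl //; apply: lerD.
    by rewrite ler_piMr ?mulr1 //; move: s0 t1; clear; lra.
  rewrite ler_wpM2l ?(Rintegral_density_le EB) //.
  by rewrite addr_ge0 // divr_ge0 ?mulr_ge0 // ltW.
apply: le_trans (ler_normD _ _) _.
have := ler_normB (q t) (q s); have := qM _ s01; have := qM _ t01.
by move: main; clear; lra.
Qed.

Lemma integrable_potential L kap eps C0 u1 u2 d1 d2 :
  energy_bounded L kap eps C0 u1 u2 d1 d2 ->
  mu.-integrable `[0, 1] (EFin \o (fun t => (sqnorm u1 u2 t - 1) ^+ 2)).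
Proof.
move=> [_ _ p1 p2 _ _ _]; apply/integrable_continuous/primitive_continuous.
exact: primitive_potential p1 p2.
Qed.

Lemma Rintegral_potential_le L kap eps C0 u1 u2 d1 d2 :
  energy_bounded L kap eps C0 u1 u2 d1 d2 ->
  \int[mu]_(t in `[0, 1]) (sqnorm u1 u2 t - 1) ^+ 2 <= 4 * eps * C0.
Proof.
move=> EB; have [L0 eps0 p1 p2 _ ie eC] := EB.
apply: (@le_trans _ _ (\int[mu]_(t in `[0, 1]) (4 * eps * density L kap eps u1 u2 d1 d2 t))).
  apply: le_Rintegral => //.
  - exact: integrable_potential EB.
  - exact: integrable_EFinZ.
  - by move=> t _; exact: potential_le.
by rewrite RintegralZl // ler_wpM2l // mulr_ge0 // ltW.
Qed.

(** Derivative of the renormalized phase; the truncation of the modulus keeps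
    it square integrable where the map vanishes and is inactive where the
    squared modulus exceeds 1/4. *)
Definition phase_speed (kap : R) (u1 u2 d1 d2 : R -> R) (t : R) : R :=
  current u1 u2 d1 d2 t / (kap * Num.max (sqnorm u1 u2 t) (1 / 4)).

(** With [m = max(|u|^2, 1/4)], the difference of the speed with 1 is
    [((j - kap) / kap - (m - 1)) / m], where [1 / m <= 4] and [m] is at least as
    close to 1 as [|u|^2]. *)
Lemma phase_speed_near1 L kap eps u1 u2 d1 d2 t : 0 < L -> 0 < eps -> 0 < kap ->
  (phase_speed kap u1 u2 d1 d2 t - 1) ^+ 2 <=
  (64 / (L * kap ^+ 2) + 128 * eps) * density L kap eps u1 u2 d1 d2 t.
Proof.
move=> L0 eps0 kap0; rewrite /phase_speed.
have := potential_le kap u1 u2 d1 d2 t L0 eps0; have := twist_le kap u1 u2 d1 d2 t L0 eps0.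
set e := density _ _ _ _ _ _ _ _; set j := current _ _ _ _ _; set r := sqnorm _ _ _.
set m := Num.max r (1 / 4); move=> Hj Hr.
have m4 : 1 / 4 <= m by rewrite le_max lexx orbT.
have m0 : 0 < m by apply: lt_le_trans m4; rewrite divr_gt0.
have mr : (m - 1) ^+ 2 <= (r - 1) ^+ 2.
  by rewrite /m; have [|] := leP r (1 / 4); [clear; nra | rewrite lexx].
have e0 : 0 <= e by exact: density_ge0.
have mi : m^-1 ^+ 2 <= 16.
  rewrite exprVn (_ : 16 = ((1 / 4) ^+ 2)^-1 :> R); last by field.
  by rewrite lef_pV2 ?posrE ?exprn_gt0 ?divr_gt0 // ler_pXn2r ?nnegrE ?divr_ge0 // ltW.
have -> : j / (kap * m) - 1 = (kap^-1 * (j - kap) - (m - 1)) * m^-1.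
  by field; rewrite !gt_eqF.
have A : (kap^-1 * (j - kap)) ^+ 2 <= 2 / (L * kap ^+ 2) * e.
  rewrite exprMn exprVn (_ : 2 / (L * kap ^+ 2) * e = (kap ^+ 2)^-1 * (2 / L * e)).
    by rewrite ler_wpM2l // invr_ge0 sqr_ge0.
  by field; rewrite !gt_eqF.
set w := kap^-1 * (j - kap) in A *.
have B : (w - (m - 1)) ^+ 2 <= 4 / (L * kap ^+ 2) * e + 8 * eps * e.
  have : (w - (m - 1)) ^+ 2 <= 2 * w ^+ 2 + 2 * (m - 1) ^+ 2.
    by have := sqr_ge0 (w + (m - 1)); clear; lra.
  by move: A mr Hr; clear; lra.
rewrite exprMn; apply: (@le_trans _ _ ((4 / (L * kap ^+ 2) * e + 8 * eps * e) * 16)).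
  by rewrite ler_pM ?sqr_ge0.
by rewrite le_eqVlt; apply/orP; left; apply/eqP; field; rewrite !gt_eqF.
Qed.

Lemma ler_dist_maxl (x y c : R) : `|Num.max x c - Num.max y c| <= `|x - y|.
Proof.
rewrite ler_norml; have [xc|xc] := leP x c; have [yc|yc] := leP y c;
  have := ler_norm (x - y); have := ler_norm (y - x); rewrite (distrC y x);
  move: xc yc; set z := `|_ - _|; clear; lra.
Qed.

Lemma measurable_phase_speed kap u1 u2 d1 d2 : kap != 0 ->
  primitive 0 1 u1 d1 -> primitive 0 1 u2 d2 ->
  measurable_fun `[(0 : R), 1] (phase_speed kap u1 u2 d1 d2).
Proof.
move=> kap0 p1 p2; apply: measurable_funM; first exact: measurable_current.
apply: measurable_segment; apply/subspace_continuousP => x x01.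
have cr := (subspace_continuousP _ _).1 (primitive_continuous (primitive_sqnorm p1 p2)) x x01.
apply: cvgV.
  rewrite mulf_neq0 // gt_eqF // lt_max; apply/orP; right.
  by rewrite divr_gt0.
apply: cvgM; first exact: cvg_cst.
apply/cvgrPdist_lt => e e0; have /cvgrPdist_lt /(_ e e0) := cr.
by apply: filterS => y; apply: le_lt_trans; exact: ler_dist_maxl.
Qed.

Lemma phase_speed_integrable L kap eps C0 u1 u2 d1 d2 (H := phase_speed kap u1 u2 d1 d2) :
  energy_bounded L kap eps C0 u1 u2 d1 d2 -> 0 < kap ->
  [/\ mu.-integrable `[0, 1] (EFin \o H),
      mu.-integrable `[0, 1] (EFin \o (fun t => (H t - 1) ^+ 2)) &
      \int[mu]_(t in `[0, 1]) (H t - 1) ^+ 2 <= (64 / (L * kap ^+ 2) + 128 * eps) * C0].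
Proof.
move=> EB kap0; have [L0 eps0 p1 p2 _ ie eC] := EB.
have mH : measurable_fun `[(0 : R), 1] H by apply: measurable_phase_speed => //; rewrite gt_eqF.
set c := 64 / _ + _.
have c0 : 0 <= c.
  by rewrite addr_ge0 ?mulr_ge0 ?invr_ge0 ?mulr_ge0 ?sqr_ge0 // ltW.
have ice : mu.-integrable `[0, 1] (EFin \o (fun t => c * density L kap eps u1 u2 d1 d2 t)).
  exact: integrable_EFinZ.
have H1 t : (H t - 1) ^+ 2 <= c * density L kap eps u1 u2 d1 d2 t by exact: phase_speed_near1.
have iH2 : mu.-integrable `[0, 1] (EFin \o (fun t => (H t - 1) ^+ 2)).
  apply: integrable_dominated ice _.
    by apply: measurable_funX; apply: measurable_funB.
  by move=> t _; rewrite ger0_norm ?sqr_ge0.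
split=> //.
  apply: (@integrable_dominated _ _ _ _ (fun t => 2 + (H t - 1) ^+ 2)) => //.
    by apply: integrable_EFinD => //; exact: integrable_segment_cst.
  move=> t _; rewrite ler_norml; have := sqr_ge0 (H t - 1 + 1); have := sqr_ge0 (H t - 1 - 1).
  by clear; lra.
apply: (@le_trans _ _ (\int[mu]_(t in `[0, 1]) (c * density L kap eps u1 u2 d1 d2 t))).
  by apply: le_Rintegral.
by rewrite RintegralZl // ler_wpM2l.
Qed.

End MeansAndPhaseSpeed.

(** * Lifting of a nonvanishing map *)

Section Lifting.
Context {R : realType}.
Local Notation mu := (@lebesgue_measure R).
Implicit Types (a b s t x : R) (f g h : R -> R).

Lemma periodic_int (f : R -> R) (T : R) : periodic f T ->
  forall (k : int) t, f (t + k%:~R * T) = f t.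
Proof.
move=> fT [n|n] t; first by rewrite -[RHS](periodicn fT n) mulr_natl.
rewrite -[LHS](periodicn fT n.+1) NegzE mulrNz mulNr mulr_natl.
by rewrite subrK.
Qed.

Lemma exists_angle (p q : R) : exists t,
  p = Num.sqrt (p ^+ 2 + q ^+ 2) * cos t /\ q = Num.sqrt (p ^+ 2 + q ^+ 2) * sin t.
Proof.
set S := p ^+ 2 + q ^+ 2; have S0 : 0 <= S by rewrite addr_ge0 ?sqr_ge0.
have [E|N0] := eqVneq (Num.sqrt S) 0.
  exists 0; move/eqP: (E); rewrite sqrtr_eq0 => SN; rewrite E !mul0r.
  have /eqP : S == 0 by rewrite eq_le SN.
  by rewrite /S => /eqP; rewrite paddr_eq0 ?sqr_ge0 // !sqrf_eq0 => /andP[/eqP-> /eqP->].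
set rho := Num.sqrt S; have rho0 : 0 < rho by rewrite lt_neqAle eq_sym N0 sqrtr_ge0.
have rho2 : rho ^+ 2 = p ^+ 2 + q ^+ 2 by rewrite sqr_sqrtr.
have cle : -1 <= p / rho <= 1.
  rewrite ler_pdivlMr // ler_pdivrMr // mulN1r mul1r -ler_norml.
  by apply: (@component_le _ _ _ q); [exact: ltW | rewrite rho2].
have sE : sin (acos (p / rho)) = `|q| / rho.
  rewrite sin_acos // (_ : 1 - _ = (q / rho) ^+ 2); last first.
    rewrite !exprMn exprVn rho2; field; rewrite -rho2 sqrf_eq0 gt_eqF //.
  by rewrite sqrtr_sqr normrM [`|rho^-1|]gtr0_norm // invr_gt0.
have cE : cos (acos (p / rho)) = p / rho by apply: acosK; rewrite in_itv.
have [q0|q0] := leP 0 q.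
  exists (acos (p / rho)); rewrite cE sE ger0_norm //.
  by split; field; rewrite gt_eqF.
exists (- acos (p / rho)); rewrite cosN sinN cE sE ltr0_norm //.
by split; field; rewrite gt_eqF.
Qed.

Lemma exists_angle_above (p q tau : R) : exists2 t, tau <= t <= tau + 2 * pi &
  p = Num.sqrt (p ^+ 2 + q ^+ 2) * cos t /\ q = Num.sqrt (p ^+ 2 + q ^+ 2) * sin t.
Proof.
have [t [pt qt]] := exists_angle p q.
have pi20 : 0 < 2 * pi :> R by rewrite mulr_gt0 // pi_gt0.
pose k : int := Num.floor ((tau - t) / (2 * pi)).
(* [k + 1] rather than [k]: the floor gives a point below [tau]. *)
exists (t + (k + 1)%:~R * (pi *+ 2)).
  have /andP[] := floor_itv ((tau - t) / (2 * pi)); rewrite -/k.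
  rewrite ler_pdivlMr // ltr_pdivrMr // intrD => H1 H2.
  by rewrite -mulr_natl; move: H1 H2; clear; nra.
rewrite (periodic_int (@cosD2pi R)) (periodic_int (@sinD2pi R)); split=> //.
Qed.

Lemma primitiveV a b f h : primitive a b f h -> (forall x, a <= x <= b -> 0 < f x) ->
  primitive a b (fun x => (f x)^-1) (fun x => - (f x ^+ 2)^-1 * h x).
Proof.
move=> pf f0; apply: (@primitive_comp _ _ _ _ _ GRing.inv (fun y => - (y ^+ 2)^-1) pf) => x xab.
  exists (f x); first exact: f0.
  move=> y /=; rewrite ltr_norml => /andP[_ yf].
  have y0 : y != 0 by rewrite gt_eqF //; move: yf; clear; lra.
  have := @is_deriveV _ id y 1 1 y0 (is_derive_id _ _).
  by rewrite /GRing.scale /= mulr1.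
apply: continuousN; apply: cvgV; first by rewrite expf_neq0 // gt_eqF // f0.
exact: exprn_continuous.
Qed.

(** Along an angle with speed [current / sqnorm] the imaginary part
    [q] of [u exp(- i theta)] satisfies [(q^2 / |u|^2)' = 0], so that [u] keeps
    the direction [exp(i theta)] it has at one point. *)
Lemma lifting a b u1 u2 d1 d2 theta dtheta m :
  primitive a b u1 d1 -> primitive a b u2 d2 -> primitive a b theta dtheta ->
  (forall x, a <= x <= b -> 0 < sqnorm u1 u2 x) ->
  (forall x, a <= x <= b -> dtheta x = current u1 u2 d1 d2 x / sqnorm u1 u2 x) ->
  a <= m <= b ->
  u1 m = Num.sqrt (sqnorm u1 u2 m) * cos (theta m) ->
  u2 m = Num.sqrt (sqnorm u1 u2 m) * sin (theta m) ->
  forall x, a <= x <= b ->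
    u1 x = Num.sqrt (sqnorm u1 u2 x) * cos (theta x) /\
    u2 x = Num.sqrt (sqnorm u1 u2 x) * sin (theta x).
Proof.
move=> p1 p2 pth r0 dthE mab u1m u2m.
have pc : primitive a b (cos \o theta) (fun t => - sin (theta t) * dtheta t).
  apply: (@primitive_comp _ _ _ _ _ cos (fun y => - sin y) pth) => x _.
    by exists 1 => //= y _; exact: is_derive_cos.
  by apply: continuousN; exact: continuous_sin.
have ps : primitive a b (sin \o theta) (fun t => cos (theta t) * dtheta t).
  apply: (@primitive_comp _ _ _ _ _ sin cos pth) => x _.
    by exists 1 => //= y _; exact: is_derive_sin.
  exact: continuous_cos.
have pr := primitive_sqnorm p1 p2.
have pi_ := primitiveV pr r0.
pose q t := u2 t * cos (theta t) - u1 t * sin (theta t).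
pose p t := u1 t * cos (theta t) + u2 t * sin (theta t).
have pq := primitiveB (primitiveM p2 pc) (primitiveM p1 ps).
have pp := primitiveD (primitiveM p1 pc) (primitiveM p2 ps).
have pn := primitiveM (primitive_sqr pq) pi_.
have n0 x y : a <= x -> x <= y -> y <= b ->
    q y ^+ 2 / sqnorm u1 u2 y = q x ^+ 2 / sqnorm u1 u2 x.
  move=> ax xy yb; have [_ /(_ x y ax xy yb)] := pn.
  rewrite (_ : \int[mu]_(t in `[x, y]) _ = 0); first by move/eqP; rewrite subr_eq0 => /eqP.
  rewrite -[RHS](mul0r (y - x)) -Rintegral_segment_cst //.
  apply: eq_Rintegral => t /set_mem; rewrite /= in_itv /= => /andP[xt ty].
  have tab : a <= t <= b by rewrite (le_trans ax) // (le_trans ty).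
  have rt := r0 t tab; rewrite dthE //= /current; rewrite /sqnorm in rt *.
  by field; rewrite gt_eqF.
have trig t : cos t ^+ 2 + sin t ^+ 2 = 1 :> R by rewrite cos2Dsin2.
have qm : q m = 0 by rewrite /q u1m u2m; ring.
have q0 x : a <= x <= b -> q x = 0.
  move=> xab; have rx := r0 x xab; move: (xab) (mab) => /andP[ax xb] /andP[am mb].
  have : q x ^+ 2 / sqnorm u1 u2 x = q m ^+ 2 / sqnorm u1 u2 m.
    by have [xm|/ltW mx] := leP x m; [rewrite (n0 x m)|rewrite (n0 m x)].
  rewrite qm expr0n /= mul0r => /eqP; rewrite mulf_eq0 invr_eq0 (gt_eqF rx) orbF.
  by rewrite sqrf_eq0 => /eqP.
have uE x : a <= x <= b -> u1 x = p x * cos (theta x) /\ u2 x = p x * sin (theta x).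
  move=> xab; have := q0 x xab; have := trig (theta x); rewrite /q /p.
  set c := cos _; set s := sin _ => E Q.
  have -> : (u1 x * c + u2 x * s) * c = u1 x * (c ^+ 2 + s ^+ 2) + s * (u2 x * c - u1 x * s) by ring.
  have -> : (u1 x * c + u2 x * s) * s = u2 x * (c ^+ 2 + s ^+ 2) - c * (u2 x * c - u1 x * s) by ring.
  by rewrite E Q !mulr0 !mulr1 addr0 subr0.
have p2E x : a <= x <= b -> p x ^+ 2 = sqnorm u1 u2 x.
  move=> /uE[e1 e2]; rewrite /sqnorm e1 e2 !exprMn -mulrDr trig mulr1 //.
have pm : 0 < p m.
  rewrite /p u1m u2m -!mulrA -mulrDr -!expr2 trig mulr1 sqrtr_gt0; exact: r0.
have ppos x : a <= x <= b -> 0 < p x.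
  move=> xab; rewrite ltNge; apply/negP => px.
  move: (xab) (mab) => /andP[ax xb] /andP[am mb].
  suff [z zab pz] : exists2 z, a <= z <= b & p z = 0.
    by have := p2E z zab; rewrite pz expr0n /= => E; have := r0 z zab; rewrite -E ltxx.
  have [xm|/ltW mx] := leP x m.
    have [||z zxm pz] := @IVT R p x m 0 xm.
    - exact: primitive_continuous (primitive_sub ax mb pp).
    - by rewrite ge_min px /= le_max (ltW pm) orbT.
    by exists z => //; move: zxm; rewrite in_itv /= => /andP[? ?]; rewrite (le_trans ax) ?(le_trans _ mb).
  have [||z zxm pz] := @IVT R p m x 0 mx.
  - exact: primitive_continuous (primitive_sub am xb pp).
  - by rewrite ge_min px orbT /= le_max (ltW pm).
  by exists z => //; move: zxm; rewrite in_itv /= => /andP[? ?]; rewrite (le_trans am) ?(le_trans _ xb).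
move=> x xab; have [e1 e2] := uE x xab.
by rewrite -(p2E x xab) sqrtr_sqr gtr0_norm ?ppos.
Qed.

End Lifting.

(** * Admissible maps *)

Section AdmissibleMaps.
Context {R : realType}.
Local Notation mu := (@lebesgue_measure R).

Lemma within_continuous_parts (D : set R) (u : R -> R * R) :
  {within D, continuous u} ->
  {within D, continuous (fst_part u)} /\ {within D, continuous (snd_part u)}.
Proof.
move=> /subspace_continuousP cu; split; apply/subspace_continuousP => x Dx.
- by apply: (@cvg_comp _ _ _ u fst _ _ _ (cu x Dx)); exact: cvg_fst.
- by apply: (@cvg_comp _ _ _ u snd _ _ _ (cu x Dx)); exact: cvg_snd.
Qed.

Lemma H1_primitive (f : R -> R) : H1 `]0, 1[ f -> {within `[0, 1], continuous f} ->
  primitive 0 1 f (weak_derivative `]0, 1[ f).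
Proof.
move=> [_ [g Lg fg]] cf.
have [Lw fw] : [set g | L2 `]0, 1[ g /\ is_weak_derivative `]0, 1[ f g]
    (weak_derivative `]0, 1[ f).
  by rewrite /weak_derivative; apply: xgetPex; exists g.
apply: weak_derivative_primitive => //; apply: L2_integrable => //.
by apply: (@bounded_measure_fin _ _ 0 1) => //; exact: subset_itv_oo_cc.
Qed.

Lemma modulus_sqr (z : R * R) : modulus z ^+ 2 = z.1 ^+ 2 + z.2 ^+ 2.
Proof. by rewrite sqr_sqrtr // addr_ge0 ?sqr_ge0. Qed.

Lemma admissible_energy_bounded (L alpha beta eps C0 : R) (u : R -> R * R) :
  0 < L -> 0 < eps -> admissible alpha u -> (energy L beta eps u <= C0%:E)%E ->
  energy_bounded L (2 * pi * eps `^ (- beta)) eps C0 (fst_part u) (snd_part u)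
    (weak_derivative `]0, 1[ (fst_part u)) (weak_derivative `]0, 1[ (snd_part u)).
Proof.
move=> L0 eps0 [h1 h2 cu u0 _] en.
have [c1 c2] := within_continuous_parts cu.
have p1 := H1_primitive h1 c1; have p2 := H1_primitive h2 c2.
set d1 := weak_derivative _ _; set d2 := weak_derivative _ _.
set u1 := fst_part u; set u2 := snd_part u; set kap := 2 * pi * _.
pose e := density L kap eps u1 u2 d1 d2.
have [m1 n1] := primitive_measurable p1; have [m2 n2] := primitive_measurable p2.
have me : measurable_fun `[(0 : R), 1] e.
  apply: measurable_funD; first apply: measurable_funD.
  - apply: measurable_funM => //; apply: measurable_funD; exact: measurable_funX.
  - apply: measurable_funM => //; apply: measurable_funX; apply: measurable_funB => //.
    by apply: measurable_funD; exact: measurable_funX.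
  - apply: measurable_funM => //; apply: measurable_funX; apply: measurable_funB => //.
    exact: measurable_current p1 p2.
have me' : measurable_fun `](0 : R), 1[ e.
  by apply: measurable_funS me => //; exact: subset_itv_oo_cc.
have enE : energy L beta eps u = (\int[mu]_(x in `]0%R, 1%R[) (e x)%:E)%E.
  apply: eq_integral => x _; congr EFin.
  by rewrite /e /density /sqnorm modulus_sqr.
have ie : mu.-integrable `]0, 1[ (EFin \o e).
  apply/integrableP; split; first exact/measurable_EFinP.
  under eq_integral => x _ do rewrite /= ger0_norm ?density_ge0 //.
  by rewrite -enE (le_lt_trans en) // ltry.
apply: Build_energy_bounded; [exact: L0|exact: eps0|exact: p1|exact: p2| | |].
- by rewrite /sqnorm /u1 /u2 /fst_part /snd_part u0 /=; ring.
- exact: integrable_oo_cc.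
- rewrite -Rintegral_oo_cc; last exact: integrable_oo_cc.
  rewrite -lee_fin /Rintegral fineK; last exact: integrable_fin_num ie.
  by rewrite -enE.
Qed.

End AdmissibleMaps.

(** * Concentration of the energy along an ultrafilter *)

Section Concentration.
Context {R : realType}.
Local Notation mu := (@lebesgue_measure R).
Implicit Types (F : set_system R) (Bad : R -> set R) (en : R -> R -> R).

(** The candidates for the set [J]: points of the open interval near which bad
    points persist along the filter. *)
Definition concentration F Bad : set R :=
  [set x | 0 < x < 1 /\
    forall d, 0 < d -> \forall eps \near F, exists2 y, `|y - x| < d & Bad eps y].

(** Each concentration point keeps a fixed amount of energy in every interval
    around it, so disjoint intervals add up. *)
Lemma concentration_energy F Bad en (A : R) : Filter F -> 0 <= A ->
  (\forall eps \near F, forall t, 0 <= en eps t) ->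
  (\forall eps \near F, mu.-integrable `[0, 1] (EFin \o en eps)) ->
  (forall a b, 0 <= a -> a < b -> b <= 1 -> \forall eps \near F,
     forall x, a <= x <= b -> Bad eps x -> 1 <= A * \int[mu]_(t in `[a, b]) en eps t) ->
  forall s a b, 0 <= a -> last a s < b -> b <= 1 -> path <%R a s ->
    (forall x, x \in s -> concentration F Bad x) ->
  \forall eps \near F, (size s)%:R <= A * \int[mu]_(t in `[a, b]) en eps t.
Proof.
move=> FF A0 en0 ien badE; elim=> [|x s IH] a b a0 /=.
  move=> ab b1 _ _; near=> eps; rewrite mulr_ge0 // Rintegral_ge0 // => t _.
  have en0e : forall t, 0 <= en eps t by near: eps.
  exact: en0e.
move=> lb b1 /andP[ax pxs] sJ.
have [_ Jx] : concentration F Bad x by apply: sJ; rewrite mem_head.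
pose y := head b s.
have xy : x < y.
  by rewrite /y; case: (s) pxs lb => [//|z s' /= /andP[]].
pose c := (x + y) / 2.
have xc : x < c by rewrite /c; move: xy; clear; lra.
have cy : c < y by rewrite /c; move: xy; clear; lra.
have lc : last c s < b.
  by move: lb cy; rewrite /y; case: (s) => //= ? ?.
have cb : c <= b.
  apply: ltW; move: lb pxs cy; rewrite /y; case: (s) => //= z s' zb /andP[xz pz] cz.
  apply: lt_trans cz _; apply: le_lt_trans zb.
  have := order_path_min lt_trans pz; rewrite -/(is_true _).
  case: (lastP s') => [//|s'' w]; rewrite last_rcons => /allP/(_ w).
  by rewrite mem_rcons mem_head => /(_ isT)/ltW.
have pcs : path <%R c s.
  by move: pxs cy; rewrite /y; case: (s) => //= z s' /andP[_ ->] ->.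
have ac : a < c by exact: lt_trans xc.
have c0 : 0 <= c by rewrite (le_trans a0) // ltW.
have IHc : \forall eps \near F, (size s)%:R <= A * \int[mu]_(t in `[c, b]) en eps t.
  by apply: IH => // z zs; apply: sJ; rewrite in_cons zs orbT.
pose d := Num.min (x - a) (c - x).
have d0 : 0 < d by rewrite /d lt_min !subr_gt0 ax xc.
have Jd := Jx d d0.
have bE := badE a c a0 ac (le_trans cb b1).
near=> eps.
have iE : mu.-integrable `[0, 1] (EFin \o en eps) by near: eps.
rewrite (@Rintegral_segment_split _ (en eps) a c b) ?(ltW ac) //; last first.
  exact: integrable_subsegment iE.
rewrite mulrDr -natr1 addrC; apply: lerD; last by near: eps.
have [z zx bz] : exists2 y, `|y - x| < d & Bad eps y by near: eps.
have bEe : forall x, a <= x <= c -> Bad eps x ->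
  1 <= A * \int[mu]_(t in `[a, c]) en eps t by near: eps.
apply: bEe bz; move: zx; rewrite /d lt_min !ltr_norml; clear; lra.
Unshelve. all: by end_near. Qed.

(** More concentration points than the total energy can pay for would give a
    contradiction at a single parameter. *)
Lemma finite_concentration F Bad en (A C0 : R) : ProperFilter F -> 0 <= A ->
  (\forall eps \near F, forall t, 0 <= en eps t) ->
  (\forall eps \near F, mu.-integrable `[0, 1] (EFin \o en eps)) ->
  (\forall eps \near F, \int[mu]_(t in `[0, 1]) en eps t <= C0) ->
  (forall a b, 0 <= a -> a < b -> b <= 1 -> \forall eps \near F,
     forall x, a <= x <= b -> Bad eps x -> 1 <= A * \int[mu]_(t in `[a, b]) en eps t) ->
  finite_set (concentration F Bad).
Proof.
move=> PF A0 en0 ien enC badE; apply: contrapT => infJ.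
pose n := (Num.truncn (A * C0)).+1.
have [S SJ Sn] := infinite_set_fset n infJ.
pose s := sort <=%R (finmap.enum_fset S).
have sJ x : x \in s -> concentration F Bad x by rewrite mem_sort => xS; apply: SJ.
have ps : path <%R 0 s.
  rewrite path_sortedE; last exact: lt_trans.
  apply/andP; split; first by apply/allP => x /sJ [/andP[]].
  by rewrite lt_sorted_uniq_le sort_uniq finmap.fset_uniq sort_le_sorted.
have l1 : last 0 s < 1.
  case: (lastP s) sJ => [//|s' w] sJ; rewrite last_rcons.
  by have [/andP[]] : concentration F Bad w by apply: sJ; rewrite mem_rcons mem_head.
have H := concentration_energy (@filter_filter _ F PF) A0 en0 ien badE (lexx 0) l1 (lexx 1) ps sJ.
have [eps [He Ce]] : exists eps, (size s)%:R <= A * \int[mu]_(t in `[0, 1]) en eps t /\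
    \int[mu]_(t in `[0, 1]) en eps t <= C0.
  by apply: (@filter_ex _ F); exact: filterI.
have : n%:R <= A * C0.
  apply: (@le_trans _ _ (size s)%:R); first by rewrite ler_nat /s size_sort.
  by apply: le_trans He _; rewrite ler_wpM2l.
by rewrite leNgt truncnS_gt.
Qed.

(** The maximality of the filter enters here: bad points that fail to persist
    along an ultrafilter are absent along it. *)
Lemma good_near F Bad x : UltraFilter F -> 0 < x < 1 -> ~ concentration F Bad x ->
  exists2 d, 0 < d & \forall eps \near F, forall y, `|y - x| < d -> ~ Bad eps y.
Proof.
move=> UF x01 Jx; apply: contrapT => H; apply: Jx; split => // d d0.
have [//|H2] := in_ultra_setVsetC [set eps | exists2 y, `|y - x| < d & Bad eps y] UF.
exfalso; apply: H; exists d => //; move: H2; apply: filterS => eps /= nex y yx by_.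
by apply: nex; exists y.
Qed.

Lemma good_compact F Bad (K : set R) : UltraFilter F -> compact K ->
  K `<=` `]0, 1[ `\` concentration F Bad ->
  \forall eps \near F, forall x, K x -> ~ Bad eps x.
Proof.
move=> UF cK KJ.
have FF : Filter F by exact: ultra_proper.
apply: ((compact_near_coveringP _).1 cK R F (fun eps x => ~ Bad eps x)) => x /KJ[x01 Jx].
have [d d0 dP] : exists2 d, 0 < d & \forall eps \near F, forall y, `|y - x| < d -> ~ Bad eps y.
  by apply: good_near => //; move: x01; rewrite /= in_itv.
exists ([set y | `|y - x| < d], [set eps | forall y, `|y - x| < d -> ~ Bad eps y]) => /=.
  by split => //; exists d => //= y; rewrite /= distrC.
by move=> [y eps] /= [yx]; apply.
Qed.

(** For increasing [n] these sets exhaust an open set [Omega]. *)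
Definition inner (Omega : set R) (n : nat) : set R :=
  [set x | forall y, `|y - x| < n.+1%:R^-1 -> Omega y].

Lemma inner_sub (Omega : set R) n : inner Omega n `<=` Omega.
Proof. by move=> x; apply; rewrite subrr normr0. Qed.

Lemma inner_le (Omega : set R) m n : (m <= n)%N -> inner Omega m `<=` inner Omega n.
Proof.
move=> mn x H y yx; apply: H; apply: lt_le_trans yx _.
by rewrite lef_pV2 ?posrE ?ltr0n // ler_nat.
Qed.

Lemma compact_inner (Omega : set R) n : Omega `<=` `]0, 1[ -> compact (inner Omega n).
Proof.
move=> O01; apply: (@subclosed_compact _ _ `[(0 : R), 1]); last 2 first.
- exact: segment_compact.
- by move=> x /inner_sub/O01; exact: subset_itv_oo_cc.
rewrite -openC openE => x /existsNP[y /not_implyP[yx nOy]].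
exists (n.+1%:R^-1 - `|y - x|) => /=; first by rewrite subr_gt0.
move=> z /= xz H; apply: nOy; apply: H.
by move: xz; rewrite ltrBrDl; exact: le_lt_trans (ler_distD x y z).
Qed.

Lemma compact_sub_inner (Omega K : set R) : open Omega -> compact K -> K `<=` Omega ->
  exists n, K `<=` inner Omega n.
Proof.
move=> oO cK KO.
suff [n _ nP] : \forall n \near \oo, K `<=` inner Omega n by exists n; apply: nP => /=.
apply: ((compact_near_coveringP _).1 cK nat \oo (fun n x => inner Omega n x)) => x /KO Ox.
have [d /= d0 dP] : \forall y \near x, Omega y by exact: open_nbhs_nbhs.
have [N _ NP] : \forall n \near \oo, n.+1%:R^-1 < d / 2 :> R.
  by apply: near_infty_natSinv_lt (PosNum _); rewrite divr_gt0.
exists ([set y | `|y - x| < d / 2], [set n | (N <= n)%N]) => /=.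
  split; last by exists N.
  by exists (d / 2) => /=; [rewrite divr_gt0 | move=> y; rewrite /= distrC].
move=> [y n] /= [yx Nn] z zy; apply: dP => /=.
by rewrite distrC (le_lt_trans (ler_distD y z x)) // [d]splitr ltrD // (lt_trans zy) // NP.
Qed.

(** Extraction of a sequence from an ultrafilter: instead of a diagonal
    argument, the members of the sequence are picked one after the other in
    sets of the ultrafilter. *)
Lemma extract_sequence F Lam Bad : UltraFilter F -> F Lam -> Lam `<=` [set eps | 0 < eps] ->
  (forall d, 0 < d -> \forall eps \near F, eps < d) ->
  open (`]0, 1[ `\` concentration F Bad) ->
  exists eps_ : nat -> R,
    [/\ forall l, Lam (eps_ l), decreasing_seq eps_, eps_ l @[l --> \oo] --> (0 : R) &
     forall K : set R, compact K -> K `<=` `]0, 1[ `\` concentration F Bad ->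
       exists n, forall l, (n <= l)%N -> forall x, K x -> ~ Bad (eps_ l) x].
Proof.
move=> UF FLam Lam0 F0 oO; set Omega := _ `\` _.
have FF : ProperFilter F by exact: ultra_proper.
have O01 : Omega `<=` `]0, 1[ by move=> x [].
pose A n (b : R) := [set eps | [/\ Lam eps, eps < n.+1%:R^-1, eps < b &
  forall x, inner Omega n x -> ~ Bad eps x]].
have A0 n b : 0 < b -> A n b !=set0.
  move=> b0; have H1 := F0 _ b0; have H2 : \forall eps \near F, eps < n.+1%:R^-1.
    by apply: F0; rewrite invr_gt0 ltr0n.
  have H3 := good_compact UF (compact_inner (n := n) O01) (@inner_sub Omega n).
  by apply: (@filter_ex _ F); near=> eps; split; near: eps.
pose pick n b := xget 0 (A n b).
have pickP n b : 0 < b -> A n b (pick n b) by move=> b0; apply: xgetPex; exact: A0.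
pose fix e n := if n is m.+1 then pick n (e m) else pick 0%N 1.
have e0 n : Lam (e n).
  by elim: n => [|n IH] /=; [have [] := pickP 0%N 1 ltr01 | have [] := pickP n.+1 (e n) (Lam0 _ IH)].
have e1 n : e n < n.+1%:R^-1 /\ forall x, inner Omega n x -> ~ Bad (e n) x.
  case: n => [|n] /=; first by have [] := pickP 0%N 1 ltr01.
  by have [] := pickP n.+1 (e n) (Lam0 _ (e0 n)).
have edec n : e n.+1 < e n by have [] := pickP n.+1 (e n) (Lam0 _ (e0 n)).
exists e; split => //.
- exact/decreasing_seqP.
- apply/cvgrPdist_lt => d d0; near=> n; rewrite sub0r normrN gtr0_norm; last exact: Lam0.
  apply: lt_trans (e1 n).1 _; near: n; exact: near_infty_natSinv_lt (PosNum d0).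
- move=> K cK KO; have [n nP] := compact_sub_inner oO cK KO.
  exists n => l nl x Kx; apply: (e1 l).2; exact: inner_le nl _ (nP _ Kx).
Unshelve. all: by end_near. Qed.

End Concentration.

(** * The renormalized phase *)

Section Phase.
Context {R : realType}.
Local Notation mu := (@lebesgue_measure R).
Implicit Types (a b s t x y z : R) (f g h : R -> R) (Omega U : set R).

(** Phrased with the segment between [x] and [y], which is what the lifting
    needs. *)
Definition same_component Omega x y : Prop :=
  forall t, Num.min x y <= t <= Num.max x y -> Omega t.

(** A point of the component of [x] that depends on the component only: the
    choice is made in the component itself, which is the same set for all its
    members. *)
Definition base_point Omega x : R := xget 0 [set y | same_component Omega x y].

Lemma same_component_sym Omega x y : same_component Omega x y -> same_component Omega y x.
Proof. by move=> H t; rewrite minC maxC; exact: H. Qed.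

Lemma same_component_trans Omega x y z : same_component Omega x y ->
  same_component Omega y z -> same_component Omega x z.
Proof.
move=> xy yz t; rewrite ge_min le_max => /andP[H1 H2].
have [ty|/ltW yt] := leP t y.
  by case/orP: H1 => H; [apply: xy | apply: yz]; rewrite ge_min le_max H ty ?orbT.
by case/orP: H2 => H; [apply: xy | apply: yz]; rewrite ge_min le_max H yt ?orbT.
Qed.

Lemma same_component_refl Omega x : Omega x -> same_component Omega x x.
Proof. by move=> Ox t; rewrite minxx maxxx => H; rewrite -(le_anti H). Qed.

Lemma base_pointP Omega x : Omega x -> same_component Omega x (base_point Omega x).
Proof.
by move=> Ox; apply: (@xgetPex _ 0 [set y | same_component Omega x y]); exists x;
  exact: same_component_refl.
Qed.

Lemma base_point_eq Omega x y : same_component Omega x y ->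
  base_point Omega x = base_point Omega y.
Proof.
move=> xy; rewrite /base_point; congr xget; apply/seteqP; split=> z /=.
  exact: same_component_trans (same_component_sym xy).
exact: same_component_trans xy.
Qed.

Lemma same_component_near Omega z : open Omega -> Omega z ->
  exists2 d, 0 < d & forall x, `|x - z| < d -> same_component Omega x z.
Proof.
move=> oO Oz; have [d /= d0 dP] : \forall y \near z, Omega y by exact: open_nbhs_nbhs.
exists d => // x xz t; rewrite ge_min le_max => tP; apply: dP => /=.
move: xz tP; rewrite !ltr_norml => /andP[H1 H2] /andP[/orP[] H3 /orP[] H4]; lra.
Qed.

(** Cauchy-Schwarz on the unit interval, as positivity of the variance. *)
Lemma Rintegral_norm_le_sqrt f : mu.-integrable `[0, 1] (EFin \o f) ->
  mu.-integrable `[0, 1] (EFin \o (fun t => f t ^+ 2)) ->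
  \int[mu]_(t in `[0, 1]) `|f t| <= Num.sqrt (\int[mu]_(t in `[0, 1]) f t ^+ 2).
Proof.
move=> if1 if2; set S := Rintegral _ _ _; set I := Rintegral _ _ _.
have in1 : mu.-integrable `[0, 1] (EFin \o (fun t => `|f t|)) by exact: integrable_norm.
have S0 : 0 <= S by apply: Rintegral_ge0.
have : 0 <= \int[mu]_(t in `[0, 1]) (f t ^+ 2 - (2 * S) * `|f t| + S ^+ 2).
  apply: Rintegral_ge0 => t _; rewrite -[f t ^+ 2]real_normK ?num_real //.
  by have := sqr_ge0 (`|f t| - S); clear; lra.
have iS : mu.-integrable `[0, 1] (EFin \o (fun t => (2 * S) * `|f t|)).
  exact: integrable_EFinZ.
have iD : mu.-integrable `[0, 1] (EFin \o (fun t => f t ^+ 2 - (2 * S) * `|f t|)).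
  exact: integrable_EFinB.
rewrite RintegralD //; last exact: integrable_segment_cst.
rewrite RintegralB // RintegralZl // Rintegral_segment_cst // -/S -/I subr0 mulr1 => H.
rewrite -(ger0_norm S0) -sqrtr_sqr; apply: ler_wsqrtr.
by move: H; clear; lra.
Qed.

(** Bound for the distance from the phase to the identity: the L^2 norm of its
    speed minus 1, and the length of one period. *)
Definition phase_error (L kap eps C0 : R) : R :=
  Num.sqrt ((64 / (L * kap ^+ 2) + 128 * eps) * C0) + 2 * pi / kap.

(** The phase is the integral of its speed, corrected on each component of
    [Omega] by a constant that makes the argument exact at the base point; the
    constant is determined modulo the period [2 pi / kap], hence can be taken
    at most as large. *)
Lemma exists_phase L kap eps C0 u1 u2 d1 d2 Omega : energy_bounded L kap eps C0 u1 u2 d1 d2 -> 0 < kap ->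
  open Omega -> Omega `<=` `]0, 1[ ->
  exists v : R -> R, [/\
    forall x, Omega x -> exists2 d, 0 < d &
      primitive (x - d) (x + d) v (phase_speed kap u1 u2 d1 d2),
    forall x, Omega x -> `|v x - x| <= phase_error L kap eps C0 &
    forall x, Omega x ->
      (forall t, Num.min x (base_point Omega x) <= t <= Num.max x (base_point Omega x) ->
         1 / 4 < sqnorm u1 u2 t) ->
      u1 x = Num.sqrt (sqnorm u1 u2 x) * cos (kap * v x) /\
      u2 x = Num.sqrt (sqnorm u1 u2 x) * sin (kap * v x)].
Proof.
move=> EB kap0 oO O01; have [L0 eps0 p1 p2 _ _ _] := EB.
set H := phase_speed kap u1 u2 d1 d2.
have [iH iH1 HC] := phase_speed_integrable EB kap0.
rewrite -/H in iH iH1 HC.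
pose W x := 0 + \int[mu]_(t in `[0, x]) H t.
have pW : primitive 0 1 W H by exact: primitive_integral.
have p2k : 0 < 2 * pi / kap by rewrite divr_gt0 // mulr_gt0 // pi_gt0.
have ex_g (p : R) : exists g : R, 0 <= g <= 2 * pi / kap /\
    u1 p = Num.sqrt (sqnorm u1 u2 p) * cos (kap * (W p + g)) /\
    u2 p = Num.sqrt (sqnorm u1 u2 p) * sin (kap * (W p + g)).
  have [t tW [c s]] := exists_angle_above (u1 p) (u2 p) (kap * W p).
  exists (t / kap - W p); split.
    move: tW => /andP[H1 H2]; rewrite subr_ge0 ler_pdivlMr // mulrC H1 /=.
    by rewrite lerBlDr ler_pdivrMr // mulrDl divfK ?gt_eqF // addrC [W p * _]mulrC.
  by rewrite (_ : kap * _ = t) //; field; rewrite gt_eqF.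
have [g gP] := choice ex_g.
pose v x := W x + g (base_point Omega x).
exists v.
have locv z : Omega z -> exists2 d, 0 < d & primitive (z - d) (z + d) v H.
  move=> Oz; have [d d0 dP] := same_component_near oO Oz.
  have d20 : 0 < d / 2 by rewrite divr_gt0.
  have in01 t : z - d / 2 <= t <= z + d / 2 -> `|t - z| < d.
    by rewrite ltr_norml; move: d0; clear; lra.
  have z01 t : z - d / 2 <= t <= z + d / 2 -> 0 < t < 1.
    move=> /in01/dP/(_ t); rewrite ge_min le_max !lexx /= => /(_ isT)/O01.
    by rewrite /= in_itv.
  exists (d / 2) => //.
  have pWz : primitive (z - d / 2) (z + d / 2) W H.
    apply: primitive_sub pW.
      by have /andP[/ltW] : 0 < z - d / 2 < 1 by apply: z01; move: d0; clear; lra.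
    by have /andP[_ /ltW] : 0 < z + d / 2 < 1 by apply: z01; move: d0; clear; lra.
  apply: eq_primitive (primitiveD pWz (primitive_cst _ _ (g (base_point Omega z)))) => x xz.
    by rewrite /v (base_point_eq (dP x (in01 x xz))).
  by rewrite addr0.
split => //.
- move=> x Ox; have := O01 x Ox; rewrite /= in_itv /= => /andP[/ltW x0 /ltW x1].
  have iHm : mu.-integrable `[0, 1] (EFin \o (fun t => H t - 1)).
    by apply: integrable_EFinB => //; exact: integrable_segment_cst.
  have in1 : mu.-integrable `[0, 1] (EFin \o (fun t => `|H t - 1|)) by exact: integrable_norm.
  rewrite /v addrAC; apply: le_trans (ler_normD _ _) _; apply: lerD.
    rewrite /W add0r -[x in _ - x]subr0 -[X in _ - X]mul1r -Rintegral_segment_cst //.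
    rewrite -RintegralB //; last 2 first.
    + exact: integrable_subsegment iH.
    + exact: integrable_segment_cst.
    apply: (@le_trans _ _ (\int[mu]_(t in `[0, x]) `|H t - 1|)).
      by apply: le_normr_Rintegral => //; exact: integrable_subsegment iHm.
    apply: (@le_trans _ _ (\int[mu]_(t in `[0, 1]) `|H t - 1|)).
      exact: Rintegral_subsegment_le.
    apply: le_trans (Rintegral_norm_le_sqrt iHm iH1) _.
    exact: ler_wsqrtr.
  have [/andP[g0 g1] _] := gP (base_point Omega x).
  by rewrite ger0_norm.
- move=> x Ox rg; set m := base_point Omega x in rg.
  pose a := Num.min x m; pose b := Num.max x m.
  have seg := base_pointP Ox; rewrite -/m in seg.
  have ab01 t : a <= t <= b -> 0 < t < 1 by move=> /seg/O01; rewrite /= in_itv.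
  have xab : a <= x <= b by rewrite ge_min le_max lexx.
  have mab : a <= m <= b by rewrite ge_min le_max lexx !orbT.
  have ab : a <= b by case/andP: xab; exact: le_trans.
  have a0 : 0 <= a by have /andP[/ltW] : 0 < a < 1 by apply: ab01; rewrite lexx.
  have b1 : b <= 1 by have /andP[_ /ltW] : 0 < b < 1 by apply: ab01; rewrite lexx ab.
  pose th t := kap * (W t + g m).
  have pth : primitive a b th (fun t => kap * (H t + 0)).
    apply/primitiveZ/primitiveD; [exact: primitive_sub pW | exact: primitive_cst].
  have [_ [gc gs]] := gP m.
  have := @lifting _ a b u1 u2 d1 d2 th _ m (primitive_sub a0 b1 p1) (primitive_sub a0 b1 p2) pth.
  apply => //.
  + by move=> t /rg; apply: lt_trans; rewrite divr_gt0.
  + move=> t tab; rewrite addr0 /H /phase_speed max_l; last exact/ltW/rg.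
    have rt : 0 < sqnorm u1 u2 t by apply: lt_trans (rg t tab); rewrite divr_gt0.
    by field; rewrite !gt_eqF.
Qed.

End Phase.

(** * Norm of the phase error, and weak limits *)

Section Convergence.
Context {R : realType}.
Local Notation mu := (@lebesgue_measure R).
Implicit Types (a b s t x y z : R) (f g h : R -> R) (U : set R).

Lemma locally_primitive_H1 U v h (M : R) : open U -> U `<=` `]0, 1[ -> L2 U h ->
  (forall x, U x -> exists2 d, 0 < d & primitive (x - d) (x + d) v h) ->
  (forall x, U x -> `|v x| <= M) ->
  [/\ L2 U v, H1 U v & is_weak_derivative U v h].
Proof.
move=> oU U01 Lh pv vM; have mU : measurable U by exact: open_measurable.
have U01c : U `<=` `[0, 1] by apply: subset_trans U01 _; exact: subset_itv_oo_cc.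
have mv : measurable_fun U v.
  apply: open_continuous_measurable_fun => // x /set_mem Ux.
  exact: locally_primitive_continuous (pv x Ux).
have Lv : L2 U v by exact: bounded_L2 U01c mv vM.
have Ufin := bounded_measure_fin mU U01c.
have wv : is_weak_derivative U v h.
  by apply: locally_primitive_weak_derivative U01 _ _ pv => //; exact: L2_integrable.
by split => //; split => //; exists h.
Qed.

Lemma L2norm_le U f (B : R) : measurable U -> U `<=` `[0, 1] -> 0 <= B ->
  measurable_fun U f -> (forall x, U x -> `|f x| <= B) -> (L2norm U f <= B%:E)%E.
Proof.
move=> mU U01 B0 mf fB; have Lf := bounded_L2 mU U01 mf fB.
have [_ if2] := (L2P f mU).1 Lf.
rewrite L2norm_sqrt // lee_fin -(ger0_norm B0) -sqrtr_sqr; apply: ler_wsqrtr.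
have ic : mu.-integrable `[0, 1] (EFin \o (fun=> B ^+ 2)) by exact: integrable_segment_cst.
have icU : mu.-integrable U (EFin \o (fun=> B ^+ 2)) by exact: integrableS ic.
apply: (@le_trans _ _ (\int[mu]_(x in U) B ^+ 2)).
  apply: le_Rintegral => // x Ux; rewrite -[f x ^+ 2]real_normK ?num_real //.
  by rewrite ler_pXn2r ?nnegrE // fB.
rewrite Rintegral_cst // ler_piMr ?sqr_ge0 //.
have Ufin := bounded_measure_fin mU U01.
have -> : 1 = fine (mu `[(0 : R), 1]) by rewrite lebesgue_measure_segment //= subr0.
apply: fine_le; rewrite ?ge0_fin_numE //; first by rewrite lebesgue_measure_segment // ltry.
by apply: le_measure; rewrite ?inE.
Qed.

Lemma L2norm_sub U f : measurable U -> U `<=` `[0, 1] ->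
  mu.-integrable `[0, 1] (EFin \o (fun x => f x ^+ 2)) ->
  (L2norm U f <= (Num.sqrt (\int[mu]_(x in `[0, 1]) f x ^+ 2))%:E)%E.
Proof.
move=> mU U01 if2; have if2U : mu.-integrable U (EFin \o (fun x => f x ^+ 2)).
  exact: integrableS if2.
rewrite L2norm_sqrt // lee_fin; apply: ler_wsqrtr.
apply: fine_le; [exact: integrable_fin_num if2U | exact: integrable_fin_num if2 |].
apply: ge0_subset_integral => //.
- by case/integrableP: if2.
- by move=> x _; rewrite lee_fin sqr_ge0.
Qed.

Lemma phase_H1norm L kap eps C0 u1 u2 d1 d2 U v :
  energy_bounded L kap eps C0 u1 u2 d1 d2 -> 0 < kap -> open U -> U `<=` `]0, 1[ ->
  (forall x, U x -> exists2 d, 0 < d &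
     primitive (x - d) (x + d) v (phase_speed kap u1 u2 d1 d2)) ->
  (forall x, U x -> `|v x - x| <= phase_error L kap eps C0) ->
  [/\ H1 U id, H1 U v & (H1norm U (v \- id)%R <= (2 * phase_error L kap eps C0)%:E)%E].
Proof.
move=> EB kap0 oU U01 pv vB; set B := phase_error _ _ _ _ in vB *.
have [iH iH1 HC] := phase_speed_integrable EB kap0.
set h := phase_speed _ _ _ _ _ in pv iH iH1 HC.
have mU : measurable U by exact: open_measurable.
have U01c : U `<=` `[0, 1] by apply: subset_trans U01 _; exact: subset_itv_oo_cc.
have k2 : 0 <= 2 * pi / kap by rewrite divr_ge0 ?mulr_ge0 ?pi_ge0 // ltW.
have B0 : 0 <= B by rewrite addr_ge0 // sqrtr_ge0.
have x1 x : U x -> `|x| <= 1.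
  by move=> /U01c; rewrite /= in_itv /= => /andP[x0 ?]; rewrite ger0_norm.
have mh : measurable_fun U h.
  have mh01 : measurable_fun `[(0 : R), 1] h by case/integrableP: iH => /measurable_EFinP.
  exact: measurable_funS mh01.
have L1 : L2 U (fun=> 1).
  by apply: (@bounded_L2 _ _ 0 1 _ 1) => // x _; rewrite normr1.
have pid x : U x -> exists2 d, 0 < d & primitive (x - d) (x + d) id (fun=> 1).
  by move=> _; exists 1 => //; exact: primitive_id.
have [_ Hid _] := locally_primitive_H1 oU U01 L1 pid x1.
have Lh1 : L2 U (fun t => h t - 1).
  apply/L2P => //; split; last by exact: integrableS iH1.
  exact: measurable_funB.
have Lh : L2 U h.
  apply/L2P => //; split => //.
  have i2 : mu.-integrable `[0, 1] (EFin \o (fun t => h t ^+ 2)).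
    apply: (@integrable_dominated _ _ _ _ (fun t => 2 * (h t - 1) ^+ 2 + 2)).
    - by apply: measurable_funX; case/integrableP: iH => /measurable_EFinP.
    - apply: integrable_EFinD; [by [] | exact: integrable_EFinZ | exact: integrable_segment_cst].
    - move=> t _; rewrite ger0_norm ?sqr_ge0 //; have := sqr_ge0 (h t - 1 - 1); clear; lra.
  exact: integrableS i2.
have vM x : U x -> `|v x| <= B + 1.
  move=> Ux; rewrite -(subrK x (v x)) (le_trans (ler_normD _ _)) // lerD ?vB ?x1 //.
have [_ Hv _] := locally_primitive_H1 oU U01 Lh pv vM.
have pvid x : U x -> exists2 d, 0 < d & primitive (x - d) (x + d) (v \- id) (fun t => h t - 1).
  move=> Ux; have [d d0 pd] := pv x Ux; exists d => //.
  by apply: primitiveB => //; exact: primitive_id.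
have [Lvid _ wvid] := locally_primitive_H1 oU U01 Lh1 pvid vB.
split => //; rewrite (H1normE oU U01c Lh1 wvid) mulr_natl mulr2n EFinD.
apply: leeD; first by apply: L2norm_le => //; case: ((L2P _ mU).1 Lvid).
apply: le_trans (L2norm_sub mU U01c iH1) _; rewrite lee_fin.
by apply: le_trans (ler_wsqrtr HC) _; rewrite lerDl.
Qed.

(** A bounded family whose means over all intervals tend to 0 tends to 0 weakly.
    Against a continuous function, this is seen on intervals where the function
    oscillates little; Cousin's lemma adds up the errors. *)
Lemma weak_limit_continuous (F : set_system R) (w : R -> R -> R) (M : R) g :
  Filter F -> 0 <= M -> continuous g ->
  (\forall e \near F, measurable_fun `[(0 : R), 1] (w e) /\
     forall t, 0 <= t <= 1 -> `|w e t| <= M) ->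
  (forall s t, 0 <= s -> s <= t -> t <= 1 ->
     \int[mu]_(x in `[s, t]) w e x @[e --> F] --> (0 : R)) ->
  \int[mu]_(x in `[0, 1]) (w e x * g x) @[e --> F] --> (0 : R).
Proof.
move=> FF M0 cg wM w0; apply/cvgr0Pnorm_le => c c0.
have c20 : 0 < c / 2 by rewrite divr_gt0.
(* The arbitrary [eta] makes the estimate additive: each interval contributes
   an error that depends on the parameter and tends to 0. *)
pose P s t := forall eta, 0 < eta -> \forall e \near F,
  `|\int[mu]_(x in `[s, t]) (w e x * g x)| <= c / 2 * (t - s) + eta.
have iw : \forall e \near F, mu.-integrable `[0, 1] (EFin \o w e) /\
    mu.-integrable `[0, 1] (EFin \o (fun x => w e x * g x)).
  apply: filterS wM => e [mw bw].
  have iwe : mu.-integrable `[0, 1] (EFin \o w e).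
    apply: integrable_dominated mw (integrable_segment_cst 0 1 M) bw.
  split => //; have cg1 : {within `[0, 1], continuous g} by exact: continuous_subspaceT.
  rewrite (_ : (fun x => w e x * g x) = (fun x => g x * w e x)).
    exact: integrable_continuousM.
  by apply/funext => x; rewrite mulrC.
have : P 0 1.
  apply: cousin => //.
    move=> s t u s0 st tu u1 Pst Ptu eta eta0.
    have eta20 : 0 < eta / 2 by rewrite divr_gt0.
    have H1 := Pst _ eta20; have H2 := Ptu _ eta20.
    near=> e.
    have [_ iwg] : mu.-integrable `[0, 1] (EFin \o w e) /\
      mu.-integrable `[0, 1] (EFin \o (fun x => w e x * g x)) by near: e.
    rewrite (@Rintegral_segment_split _ _ s t u) //; last exact: integrable_subsegment iwg.
    have K1 : `|\int[mu]_(x in `[s, t]) (w e x * g x)| <= c / 2 * (t - s) + eta / 2 by near: e.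
    have K2 : `|\int[mu]_(x in `[t, u]) (w e x * g x)| <= c / 2 * (u - t) + eta / 2 by near: e.
    apply: le_trans (ler_normD _ _) _; move: K1 K2; clear; lra.
  move=> z z01; have M1 : 0 < M + 1 by rewrite ltr_wpDl.
  have cM : 0 < c / 2 / (M + 1) by rewrite divr_gt0.
  have /cvgrPdist_lt /(_ _ cM) [d /= d0 dP] := cg z.
  exists d => // s t s0 sz zt t1 zs tz eta eta0.
  have st := le_trans sz zt.
  have e1 : 0 < eta / (`|g z| + 1) by rewrite divr_gt0 // ltr_wpDl.
  have /cvgr0Pnorm_le /(_ _ e1) H1 := w0 s t s0 st t1.
  near=> e.
  have [iw1 iwg] : mu.-integrable `[0, 1] (EFin \o w e) /\
    mu.-integrable `[0, 1] (EFin \o (fun x => w e x * g x)) by near: e.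
  have [_ bw] : measurable_fun `[(0 : R), 1] (w e) /\
     forall t, 0 <= t <= 1 -> `|w e t| <= M by near: e.
  have K1 : `|\int[mu]_(x in `[s, t]) w e x| <= eta / (`|g z| + 1) by near: e.
  have iws : mu.-integrable `[s, t] (EFin \o w e) by exact: integrable_subsegment iw1.
  have iwgs : mu.-integrable `[s, t] (EFin \o (fun x => w e x * g x)).
    exact: integrable_subsegment iwg.
  have izw : mu.-integrable `[s, t] (EFin \o (fun x => g z * w e x)) by exact: integrable_EFinZ.
  have -> : \int[mu]_(x in `[s, t]) (w e x * g x) =
     \int[mu]_(x in `[s, t]) (w e x * g x - g z * w e x) + g z * \int[mu]_(x in `[s, t]) w e x.
    by rewrite RintegralB // RintegralZl // subrK.
  apply: le_trans (ler_normD _ _) _; apply: lerD.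
    rewrite -Rintegral_segment_cst //; apply: ler_norm_Rintegral => //.
    - exact: integrable_EFinB.
    - exact: integrable_segment_cst.
    move=> x; rewrite /= in_itv /= => /andP[sx xt].
    rewrite [g z * _]mulrC -mulrBr normrM.
    have x01 : 0 <= x <= 1 by rewrite (le_trans s0) // (le_trans xt).
    have gx : `|g x - g z| <= c / 2 / (M + 1).
      apply/ltW; rewrite distrC; apply: dP; rewrite /= ltr_norml.
      by move: sx xt zs tz; clear; lra.
    apply: (@le_trans _ _ ((M + 1) * (c / 2 / (M + 1)))).
      by apply: ler_pM => //; apply: le_trans (bw _ x01) _; rewrite lerDl.
    by rewrite mulrC divfK // gt_eqF.
  rewrite normrM; apply: (@le_trans _ _ ((`|g z| + 1) * (eta / (`|g z| + 1)))).
    by apply: ler_pM => //; rewrite lerDl.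
  by rewrite mulrC divfK // gt_eqF // ltr_wpDl.
by move=> /(_ _ c20); apply: filterS => e; rewrite subr0 mulr1 -splitr.
Unshelve. all: by end_near. Qed.

(** Continuous functions are dense in L^1, and the family is bounded. *)
Lemma weak_limit (F : set_system R) (w : R -> R -> R) (M : R) psi :
  Filter F -> 0 <= M -> mu.-integrable `[0, 1] (EFin \o psi) ->
  (\forall e \near F, measurable_fun `[(0 : R), 1] (w e) /\
     forall t, 0 <= t <= 1 -> `|w e t| <= M) ->
  (forall s t, 0 <= s -> s <= t -> t <= 1 ->
     \int[mu]_(x in `[s, t]) w e x @[e --> F] --> (0 : R)) ->
  \int[mu]_(x in `[0, 1]) (w e x * psi x) @[e --> F] --> (0 : R).
Proof.
move=> FF M0 ipsi wM w0; apply/cvgr0Pnorm_le => c c0.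
have c20 : 0 < c / 2 by rewrite divr_gt0.
have M1 : 0 < M + 1 by rewrite ltr_wpDl.
have fin01 : (mu `[0%R, 1%R] < +oo)%E by rewrite lebesgue_measure_segment // ltry.
have [g_ [cg ig gpsi]] := approximation_continuous_integrable (measurable_itv _) fin01 ipsi.
have [n Hn] : exists n, \int[mu]_(x in `[0, 1]) `|psi x - g_ n x| <= c / 2 / (M + 1).
  have cM : 0 < c / 2 / (M + 1) by rewrite divr_gt0.
  move/fine_cvgP: gpsi => [_ /cvgr0Pnorm_le /(_ _ cM) [n _ nP]].
  exists n; have := nP n (leqnn n) => /=; apply: le_trans; exact: ler_norm.
have := weak_limit_continuous FF M0 (cg n) wM w0.
move=> /cvgr0Pnorm_le /(_ _ c20) H.
near=> e.
have [mw bw] : measurable_fun `[(0 : R), 1] (w e) /\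
     forall t, 0 <= t <= 1 -> `|w e t| <= M by near: e.
have K : `|\int[mu]_(x in `[0, 1]) (w e x * g_ n x)| <= c / 2 by near: e.
have iprod k : mu.-integrable `[0, 1] (EFin \o k) ->
    mu.-integrable `[0, 1] (EFin \o (fun x => w e x * k x)).
  move=> ik; apply: (@integrable_dominated _ _ _ _ (fun x => M * `|k x|)).
  - by apply: measurable_funM => //; case/integrableP: ik => /measurable_EFinP.
  - by apply: integrable_EFinZ => //; exact: integrable_norm.
  - by move=> t t01; rewrite normrM ler_wpM2r // bw.
have igd : mu.-integrable `[0, 1] (EFin \o (fun x => psi x - g_ n x)).
  exact: integrable_EFinB.
have -> : \int[mu]_(x in `[0, 1]) (w e x * psi x) =
   \int[mu]_(x in `[0, 1]) (w e x * (psi x - g_ n x)) + \int[mu]_(x in `[0, 1]) (w e x * g_ n x).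
  rewrite -RintegralD //; try exact: iprod.
  by apply: eq_Rintegral => x _; ring.
apply: le_trans (ler_normD _ _) _; rewrite [c in leRHS]splitr; apply: lerD => //.
have ind : mu.-integrable `[0, 1] (EFin \o (fun x => `|psi x - g_ n x|)).
  exact: integrable_norm.
apply: (@le_trans _ _ (\int[mu]_(x in `[0, 1]) ((M + 1) * `|psi x - g_ n x|))).
  apply: ler_norm_Rintegral => //; [exact: iprod | exact: integrable_EFinZ |].
  move=> x; rewrite /= in_itv /= => x01; rewrite normrM ler_wpM2r //.
  by apply: le_trans (bw _ x01) _; rewrite lerDl.
by rewrite RintegralZl // mulrC -ler_pdivlMr.
Unshelve. all: by end_near. Qed.

End Convergence.

(** * The limit of small parameters *)

Section SmallParameters.
Context {R : realType}.
Local Notation mu := (@lebesgue_measure R).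

Section SmallParameter.
Context (Lam : set R) (Lam0 : Lam `<=` [set eps | 0 < eps]) (cl0 : closure Lam 0).
Local Notation F0 := (within Lam (nbhs (0 : R))).

Lemma small_filter : ProperFilter F0.
Proof. exact: within_nbhs_proper. Qed.

Lemma near_small (d : R) : 0 < d -> \forall eps \near F0, eps < d.
Proof.
move=> d0; exists d => //= eps; rewrite /= sub0r normrN => + Le.
by rewrite gtr0_norm //; exact: Lam0.
Qed.

Lemma near_Lam : \forall eps \near F0, Lam eps.
Proof. by exists 1 => //=. Qed.

Lemma cvg_small : eps @[eps --> F0] --> (0 : R).
Proof. exact: cvg_within. Qed.

Lemma cvg_small_powR (beta : R) : 0 < beta -> eps `^ beta @[eps --> F0] --> (0 : R).
Proof.
move=> b0; have FF := small_filter; apply/cvgr0Pnorm_lt => d d0; near=> eps.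
have Le : Lam eps by near: eps; exact: near_Lam.
rewrite ger0_norm ?powR_ge0 //.
have -> : d = (d `^ beta^-1) `^ beta by rewrite -powRrM mulVf ?gt_eqF // powRr1 // ltW.
apply: gt0_ltr_powR => //; rewrite ?nnegrE ?powR_ge0 //; first exact/ltW/Lam0.
by near: eps; apply: near_small; rewrite powR_gt0.
Unshelve. all: by end_near. Qed.

Lemma phase_errorE (L beta eps C0 : R) : 0 < eps ->
  phase_error L (2 * pi * eps `^ (- beta)) eps C0 =
  Num.sqrt ((64 / (L * (2 * pi) ^+ 2) * (eps `^ beta * eps `^ beta) + 128 * eps) * C0)
  + eps `^ beta.
Proof.
move=> e0; have p0 : 0 < eps `^ beta by exact: powR_gt0.
have pi0 : 0 < pi :> R by exact: pi_gt0.
rewrite /phase_error powRN; move: (pi : R) pi0 => P P0; congr (Num.sqrt ((_ + _) * _) + _); last first.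
  by field; rewrite !gt_eqF.
rewrite [(_ / _) ^+ 2]exprMn exprVn [L * (_ * _)]mulrA invfM invrK.
by rewrite [(eps `^ beta) ^+ 2]expr2 mulrA.
Qed.

Lemma cvg_phase_error (L beta C0 : R) : 0 < beta ->
  phase_error L (2 * pi * eps `^ (- beta)) eps C0 @[eps --> F0] --> (0 : R).
Proof.
move=> b0; have FF := small_filter; have cp := cvg_small_powR b0.
pose G (eps : R) :=
  Num.sqrt ((64 / (L * (2 * pi) ^+ 2) * (eps `^ beta * eps `^ beta) + 128 * eps) * C0)
  + eps `^ beta.
suff cG : G eps @[eps --> F0] --> (0 : R).
  apply: cvg_trans cG; apply: near_eq_cvg; near=> eps.
  by rewrite phase_errorE //; apply: Lam0; near: eps; exact: near_Lam.
rewrite -[X in _ --> X](_ : Num.sqrt ((64 / (L * (2 * pi) ^+ 2) * (0 * 0) + 128 * 0) * C0) + 0 = 0); last first.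
  by rewrite !(mulr0, addr0, mul0r) sqrtr0.
apply: cvgD => //; apply: (@cvg_comp _ _ _ _ Num.sqrt); last exact: sqrt_continuous.
apply: cvgM; last exact: cvg_cst.
apply: cvgD; apply: cvgM; [exact: cvg_cst | exact: cvgM | exact: cvg_cst | exact: cvg_small].
Unshelve. all: by end_near. Qed.

End SmallParameter.

Lemma cvge0_squeeze (T : Type) (F : set_system T) (f : T -> \bar R) (b : T -> R) :
  Filter F -> (\forall i \near F, (0 <= f i <= (b i)%:E)%E) ->
  b i @[i --> F] --> (0 : R) -> f i @[i --> F] --> 0%E.
Proof.
move=> FF fb b0; apply: (squeeze_cvge fb); first exact: cvg_cst.
by apply: cvg_EFin => //; exact: nearW.
Qed.

Lemma H1norm_ge0 (U : set R) f : (0 <= H1norm U f)%E.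
Proof. by rewrite adde_ge0 //; exact: Lnorm_ge0. Qed.

(** If each compact subset of [Omega] is eventually good, then so are,
    uniformly, the segments from the points of a compact set to their base
    points: these are locally a fixed segment and a short one. *)
Lemma compact_hull_near (Omega K : set R) (good : nat -> set R) : open Omega ->
  compact K -> K `<=` Omega ->
  (forall K', compact K' -> K' `<=` Omega -> \forall l \near \oo, K' `<=` good l) ->
  \forall l \near \oo, forall x, K x -> forall t,
    Num.min x (base_point Omega x) <= t <= Num.max x (base_point Omega x) -> good l t.
Proof.
move=> oO cK KO goodK.
apply: ((compact_near_coveringP _).1 cK nat \oo (fun l x => forall t,
    Num.min x (base_point Omega x) <= t <= Num.max x (base_point Omega x) -> good l t)).
move=> x /KO Ox; have [d d0 dP] := same_component_near oO Ox.
set m := base_point Omega x.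
have g1 : \forall l \near \oo, `[Num.min x m, Num.max x m] `<=` good l.
  apply: goodK; first exact: segment_compact.
  by move=> t /=; rewrite in_itv /=; exact: base_pointP.
have g2 : \forall l \near \oo, `[x - d / 2, x + d / 2] `<=` good l.
  apply: goodK; first exact: segment_compact.
  move=> t /=; rewrite in_itv /= => tx; apply: (dP t) => //.
    by rewrite ltr_norml; move: tx d0; clear; lra.
  by rewrite ge_min le_max !lexx.
exists ([set y | `|y - x| < d / 2],
  [set l | `[Num.min x m, Num.max x m] `<=` good l /\ `[x - d / 2, x + d / 2] `<=` good l]) => /=.
  split; last exact: filterI.
  by exists (d / 2); [rewrite /= divr_gt0 | move=> y; rewrite /= distrC].
move=> [y l] /= [yx [G1 G2]] t.
have -> : base_point Omega y = m.
  by apply/base_point_eq/dP; move: yx d0; clear; lra.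
move=> tym; have [H|H] := boolP (Num.min x m <= t <= Num.max x m).
  by apply: G1; rewrite /= in_itv.
apply: G2; rewrite /= in_itv /=; move: yx tym H; rewrite ltr_norml negb_and -!ltNge.
rewrite !ge_min !le_max !lt_min !gt_max.
move=> /andP[H1 H2] /andP[/orP[] H3 /orP[] H4] /orP[/andP[H5 H6]|/andP[H5 H6]];
  move: H1 H2 H3 H4 H5 H6; clear; lra.
Qed.

End SmallParameters.

(** * Families of maps with bounded energy *)

Section Family.
Context {R : realType} (L alpha beta C0 : R) (Lam : set R) (u : R -> R -> R * R).
Context (L0 : 0 < L) (b0 : 0 < beta).
Context (Lam0 : Lam `<=` [set eps | 0 < eps]) (cl0 : closure Lam 0).
Context (adm : forall eps, Lam eps -> admissible alpha (u eps)).
Context (enC : forall eps, Lam eps -> (energy L beta eps (u eps) <= C0%:E)%E).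

Local Notation mu := (@lebesgue_measure R).
Local Notation F0 := (within Lam (nbhs (0 : R))).

Let u1 eps := fst_part (u eps).
Let u2 eps := snd_part (u eps).
Let d1 eps := weak_derivative `]0, 1[ (u1 eps).
Let d2 eps := weak_derivative `]0, 1[ (u2 eps).
Let kap eps := 2 * pi * eps `^ (- beta).
Let M := 2 + 64 * C0.

Lemma family_bounded eps : Lam eps ->
  energy_bounded L (kap eps) eps C0 (u1 eps) (u2 eps) (d1 eps) (d2 eps).
Proof.
move=> Le; apply: (@admissible_energy_bounded _ _ alpha); [exact: L0 | exact: Lam0 | |].
- exact: adm.
- exact: enC.
Qed.

Lemma frequency_gt0 eps : Lam eps -> 0 < kap eps.
Proof. by move=> Le; rewrite mulr_gt0 ?powR_gt0 ?mulr_gt0 ?pi_gt0 //; exact: Lam0. Qed.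

Let FF := small_filter cl0.

Lemma bound_ge0 : 0 <= C0.
Proof.
have [eps Le] : exists eps, Lam eps by apply: (@filter_ex _ F0); exact: near_Lam.
exact: energy_bounded_ge0 (family_bounded Le).
Qed.

Lemma modulus_cvg_L2 : cvg_L2 F0 `]0, 1[ (fun eps x => modulus (u eps x) ^+ 2) (cst 1).
Proof.
have sub : `](0 : R), 1[ `<=` `[0, 1] by exact: subset_itv_oo_cc.
have E eps : (fun x => modulus (u eps x) ^+ 2) \- cst 1 =
    (fun x => sqnorm (u1 eps) (u2 eps) x - 1).
  by apply/funext => x /=; rewrite modulus_sqr.
split.
  have near_L := near_Lam Lam; near=> eps.
  have EB : energy_bounded L (kap eps) eps C0 (u1 eps) (u2 eps) (d1 eps) (d2 eps).
    by apply: family_bounded; near: eps.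
  have ip := integrable_potential EB; rewrite E; have [_ _ p1 p2 _ _ _] := EB.
  apply/L2P => //; split; last by exact: integrableS ip.
  have [mr _] := primitive_measurable (primitive_sqnorm p1 p2).
  by apply: measurable_funB => //; exact: measurable_funS mr.
apply: (@cvge0_squeeze _ _ _ _ (fun eps => Num.sqrt (4 * eps * C0))).
  have near_L := near_Lam Lam; near=> eps; rewrite Lnorm_ge0 /=.
  have EB : energy_bounded L (kap eps) eps C0 (u1 eps) (u2 eps) (d1 eps) (d2 eps).
    by apply: family_bounded; near: eps.
  rewrite E; apply: le_trans (L2norm_sub _ sub (integrable_potential EB)) _ => //.
  by rewrite lee_fin ler_wsqrtr // (Rintegral_potential_le EB).
rewrite -[X in _ --> X](_ : Num.sqrt (4 * 0 * C0) = 0); last by rewrite mulr0 mul0r sqrtr0.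
apply: (@cvg_comp _ _ _ _ Num.sqrt); last exact: sqrt_continuous.
by apply: cvgM; [apply: cvgM; [exact: cvg_cst | exact: cvg_small] | exact: cvg_cst].
Unshelve. all: by end_near. Qed.

Lemma frequencyV eps : (kap eps)^-1 = (2 * pi)^-1 * eps `^ beta.
Proof. by rewrite /kap powRN invfM invrK. Qed.

Lemma segment_mean_cvg (w : R -> R -> R) (C1 : R) :
  (forall eps s t, Lam eps -> 0 <= s -> s <= t -> t <= 1 ->
     `|kap eps * \int[mu]_(x in `[s, t]) w eps x| <= C1) ->
  forall s t, 0 <= s -> s <= t -> t <= 1 ->
    \int[mu]_(x in `[s, t]) w eps x @[eps --> F0] --> (0 : R).
Proof.
move=> wC s t s0 st t1.
have cb : C1 * ((2 * pi)^-1 * eps `^ beta) @[eps --> F0] --> (0 : R).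
  rewrite -[X in _ --> X](_ : C1 * ((2 * pi)^-1 * 0) = 0); last by rewrite !mulr0.
  apply: cvgM; first exact: cvg_cst.
  by apply: cvgM; [exact: cvg_cst | exact: cvg_small_powR].
apply/cvgr0Pnorm_le => e e0; move/cvgr0Pnorm_le : cb => /(_ _ e0) cb.
have near_L := near_Lam Lam; near=> eps.
have Le : Lam eps by near: eps.
apply: (@le_trans _ _ (C1 * ((2 * pi)^-1 * eps `^ beta))).
  rewrite -frequencyV ler_pdivlMr ?frequency_gt0 // mulrC.
  rewrite -[kap eps in leLHS]gtr0_norm ?frequency_gt0 // -normrM; exact: wC.
by apply: le_trans (ler_norm _) _; near: eps.
Unshelve. all: by end_near. Qed.

Lemma components_weak_cvg (psi : R -> R) : L2 `]0, 1[ psi ->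
  \int[mu]_(x in `]0, 1[) (u1 eps x * psi x) @[eps --> F0] --> (0 : R) /\
  \int[mu]_(x in `]0, 1[) (u2 eps x * psi x) @[eps --> F0] --> (0 : R).
Proof.
move=> Lpsi; have near_L := near_Lam Lam.
have sub : `](0 : R), 1[ `<=` `[0, 1] by exact: subset_itv_oo_cc.
have ipsi : mu.-integrable `[0, 1] (EFin \o psi).
  by apply: integrable_oo_cc; apply: L2_integrable => //; exact: bounded_measure_fin sub.
have M0 : 0 <= M by rewrite addr_ge0 // mulr_ge0 // bound_ge0.
have bnd : \forall eps \near F0,
   (measurable_fun `[(0 : R), 1] (u1 eps) /\ forall t, 0 <= t <= 1 -> `|u1 eps t| <= M) /\
   (measurable_fun `[(0 : R), 1] (u2 eps) /\ forall t, 0 <= t <= 1 -> `|u2 eps t| <= M).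
  near=> eps; have EB : energy_bounded L (kap eps) eps C0 (u1 eps) (u2 eps) (d1 eps) (d2 eps).
    by apply: family_bounded; near: eps.
  have [_ _ /primitive_measurable[m1 _] /primitive_measurable[m2 _] _ _ _] := EB.
  split; split => // t t01; have := sup_bound EB t01; first exact: component_le.
  by rewrite /sqnorm addrC; exact: component_le.
pose C1 := 3 * M + M * (M ^+ 2 + 1) + (3 + 2 * M / L) * C0.
have oo_cc (w : R -> R -> R) :
    (\forall eps \near F0, measurable_fun `[(0 : R), 1] (w eps) /\
       forall t, 0 <= t <= 1 -> `|w eps t| <= M) ->
    \int[mu]_(x in `[0, 1]) (w eps x * psi x) @[eps --> F0] --> (0 : R) ->
    \int[mu]_(x in `]0, 1[) (w eps x * psi x) @[eps --> F0] --> (0 : R).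
  move=> bw; apply: cvg_trans; apply: near_eq_cvg; near=> eps.
  have [mw wM] : measurable_fun `[(0 : R), 1] (w eps) /\
    forall t, 0 <= t <= 1 -> `|w eps t| <= M by near: eps.
  rewrite Rintegral_oo_cc //; apply: (@integrable_dominated _ _ _ _ (fun x => M * `|psi x|)).
  - by apply: measurable_funM => //; case/integrableP: ipsi => /measurable_EFinP.
  - by apply: integrable_EFinZ => //; exact: integrable_norm.
  - by move=> t t01; rewrite normrM ler_wpM2r // wM.
have b1 : \forall eps \near F0, measurable_fun `[(0 : R), 1] (u1 eps) /\
    forall t, 0 <= t <= 1 -> `|u1 eps t| <= M by apply: filterS bnd => eps [].
have b2 : \forall eps \near F0, measurable_fun `[(0 : R), 1] (u2 eps) /\
    forall t, 0 <= t <= 1 -> `|u2 eps t| <= M by apply: filterS bnd => eps [].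
split.
- apply: (oo_cc _ b1); apply: (weak_limit _ M0 ipsi b1).
  apply: (@segment_mean_cvg _ C1) => eps s t Le s0 st t1.
  exact: segment_mean_bound (family_bounded Le) s0 st t1.
- apply: (oo_cc _ b2); apply: (weak_limit _ M0 ipsi b2).
  apply: (@segment_mean_cvg _ C1) => eps s t Le s0 st t1.
  exact: segment_mean_bound (energy_bounded_rotate (family_bounded Le)) s0 st t1.
Unshelve. all: by end_near. Qed.

Lemma family_weak_cvg : weak_cvg_L2C F0 `]0, 1[ u (cst (0, 0)).
Proof.
have sub : `](0 : R), 1[ `<=` `[0, 1] by exact: subset_itv_oo_cc.
have near_L := near_Lam Lam.
have L20 : L2 `]0, 1[ (fun=> 0 : R).
  by apply: (@bounded_L2 _ _ 0 1 _ 0) => // x _; rewrite normr0.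
have Lu : \forall eps \near F0, L2C `]0, 1[ (u eps).
  by apply: filterS near_L => eps /adm [[L1 _] [L2_ _] _ _ _].
split => // psi [Lp1 Lp2].
have -> : inner_L2C `]0, 1[ (cst (0, 0)) psi = (0, 0).
  by rewrite /inner_L2C; congr (_, _); rewrite -[RHS](mul0r (fine (mu `]0%R, 1%R[))) -Rintegral_cst //;
    apply: eq_Rintegral => x _ /=; ring.
have [c11 c21] := components_weak_cvg Lp1; have [c12 c22] := components_weak_cvg Lp2.
have fin01 : (mu `]0%R, 1%R[ < +oo)%E by exact: bounded_measure_fin sub.
have ip (f g : R -> R) : L2 `]0, 1[ f -> L2 `]0, 1[ g ->
    mu.-integrable `]0, 1[ (EFin \o (fun x => f x * g x)).
  move=> /(L2P _ (measurable_itv _))[mf if2] /(L2P _ (measurable_itv _))[mg ig2].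
  have i2 : mu.-integrable `]0, 1[ (EFin \o (fun x => f x ^+ 2 + g x ^+ 2)).
    exact: integrable_EFinD.
  apply: (le_integrable _ _ _ i2) => //.
    by apply/measurable_EFinP; exact: measurable_funM.
  move=> x _ /=; rewrite lee_fin [leRHS]ger0_norm ?addr_ge0 ?sqr_ge0 // ler_norml.
  by have := sqr_ge0 (f x + g x); have := sqr_ge0 (f x - g x); have := sqr_ge0 (f x);
    have := sqr_ge0 (g x); lra.
have A : \int[mu]_(x in `]0, 1[) ((u eps x).1 * (psi x).1 + (u eps x).2 * (psi x).2)
    @[eps --> F0] --> (0 : R).
  rewrite -[X in _ --> X](addr0 0); apply: cvg_trans (cvgD c11 c22).
  apply: near_eq_cvg; apply: filterS Lu => eps [L1 L2_] /=.
  by rewrite RintegralD //; exact: ip.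
have B : \int[mu]_(x in `]0, 1[) ((u eps x).2 * (psi x).1 - (u eps x).1 * (psi x).2)
    @[eps --> F0] --> (0 : R).
  rewrite -[X in _ --> X](subr0 0); apply: cvg_trans (cvgB c21 c12).
  apply: near_eq_cvg; apply: filterS Lu => eps [L1 L2_] /=.
  by rewrite RintegralB //; exact: ip.
exact: (@cvg_pair _ _ _ _ (nbhs (0 : R)) (nbhs (0 : R)) _ _ _ _ _ A B).
Qed.

Definition bad_points eps : set R :=
  [set x | 0 <= x <= 1 /\ sqnorm (u1 eps) (u2 eps) x <= 1 / 4].

Let en eps := density L (kap eps) eps (u1 eps) (u2 eps) (d1 eps) (d2 eps).

(** [bad_point_energy] holds on a given interval as soon as the parameter is
    small compared with its length. *)
Lemma family_finite_concentration (F : set_system R) : ProperFilter F -> F0 `<=` F ->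
  finite_set (concentration F bad_points).
Proof.
move=> PF F0F; have C00 := bound_ge0.
have near_L : \forall eps \near F, Lam eps by apply: F0F; exact: near_Lam.
apply: (@finite_concentration _ F bad_points en (64 * (2 + 64 * C0)) C0).
- by rewrite mulr_ge0 // addr_ge0 // mulr_ge0.
- apply: filterS near_L => eps Le t; apply: density_ge0 => //; exact: Lam0.
- by apply: filterS near_L => eps /family_bounded[].
- by apply: filterS near_L => eps /family_bounded[].
- move=> a b a0 ab b1.
  have d0 : 0 < (b - a) / (16 * C0 + 1).
    by rewrite divr_gt0 ?subr_gt0 // ltr_wpDl // mulr_ge0.
  have small : \forall eps \near F, eps < (b - a) / (16 * C0 + 1).
    by apply: F0F; exact: near_small.
  apply: filterS2 near_L small => eps Le se x xab [_ rx].
  have e0 : 0 < eps by exact: Lam0.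
  apply: (bad_point_energy (family_bounded Le)) rx => //.
  have : eps * (16 * C0 + 1) < b - a by rewrite -ltr_pdivlMr // ltr_wpDl // mulr_ge0.
  by lra.
Qed.

Lemma family_subsequence :
  exists (J : set R) (eps_ : nat -> R) (v : nat -> R -> R),
    [/\ finite_set J /\ J `<=` `]0, 1[,
        [/\ forall l, Lam (eps_ l), decreasing_seq eps_ & eps_ l @[l --> \oo] --> 0],
        forall K : set R, compact K -> K `<=` `]0, 1[ `\` J ->
          exists2 eps0 : R, 0 < eps0 &
            forall l, eps_ l < eps0 ->
              [/\ forall x, K x -> 0 < modulus (u (eps_ l) x),
                  {within K, continuous (v l)} &
                  forall x, K x -> u (eps_ l) x =
                    modulus (u (eps_ l) x) *: expi (2 * pi * v l x / eps_ l `^ beta)] &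
        cvg_H1loc \oo (`]0, 1[ `\` J) v id].
Proof.
have [F [UF F0F]] := ultraFilterLemma FF.
have PF : ProperFilter F by exact: ultra_proper.
set J := concentration F bad_points.
have finJ : finite_set J by exact: family_finite_concentration.
pose Omega := `](0 : R), 1[ `\` J.
have O01 : Omega `<=` `]0, 1[ by move=> x [].
have oO : open Omega.
  apply: openI; first exact: itv_open.
  rewrite openC; apply: (accessible_finite_set_closed.1 _ _ finJ).
  exact/hausdorff_accessible/Rhausdorff.
have FLam : F Lam by apply: F0F; exact: near_Lam.
have Fsmall d : 0 < d -> \forall eps \near F, eps < d.
  by move=> d0; apply: F0F; exact: near_small.
have [e [eL edec e0 eK]] := extract_sequence UF FLam Lam0 Fsmall oO.
have ex_v l := exists_phase (family_bounded (eL l)) (frequency_gt0 (eL l)) oO O01.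
have [v vP] := choice ex_v.
have cvge : e l @[l --> \oo] --> F0.
  move=> A [d /= d0 dA]; move/cvgrPdist_lt : e0 => /(_ _ d0).
  by apply: filterS => l /dA; apply; exact: eL.
exists J, e, v; split.
- by split => // x [] /=; rewrite in_itv.
- by [].
- move=> K cK KO.
  have [n nP] : exists n, forall l, (n <= l)%N -> forall x, K x -> forall t,
      Num.min x (base_point Omega x) <= t <= Num.max x (base_point Omega x) ->
      ~ bad_points (e l) t.
    have [n _ nP] : \forall l \near \oo, forall x, K x -> forall t,
        Num.min x (base_point Omega x) <= t <= Num.max x (base_point Omega x) ->
        (~` bad_points (e l)) t.
      apply: compact_hull_near => // K' cK' KO'; have [n nP] := eK K' cK' KO'.
      by exists n => // l nl x; exact: nP.
    by exists n => l nl; exact: nP.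
  exists (e n); first exact/Lam0/eL.
  move=> l eln; have nl : (n <= l)%N.
    by rewrite -(edec n l); exact: ltW.
  have [locv _ lift] := vP l.
  have good x : K x -> forall t,
      Num.min x (base_point Omega x) <= t <= Num.max x (base_point Omega x) ->
      1 / 4 < sqnorm (u1 (e l)) (u2 (e l)) t.
    move=> Kx t tx; rewrite ltNge; apply/negP => bad; apply: (nP l nl x Kx t tx).
    split => //; have /O01 : Omega t by apply: base_pointP tx; exact: KO.
    by rewrite /= in_itv /= => /andP[/ltW -> /ltW ->].
  have modE x : modulus (u (e l) x) = Num.sqrt (sqnorm (u1 (e l)) (u2 (e l)) x) by [].
  split.
  + move=> x Kx; rewrite modE sqrtr_gt0; apply: lt_trans (good x Kx x _).
      by rewrite divr_gt0.
    by rewrite ge_min le_max lexx.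
  + apply: continuous_in_subspaceT => x /set_mem Kx.
    exact: locally_primitive_continuous (locv x (KO x Kx)).
  + move=> x Kx; have [c s] := lift x (KO x Kx) (good x Kx).
    have -> : 2 * pi * v l x / e l `^ beta = kap (e l) * v l x.
      by rewrite /kap powRN mulrAC.
    by rewrite [LHS]surjective_pairing modE; congr (_, _).
- move=> U oU cU UO.
  have UO' : U `<=` Omega by apply: subset_trans UO; exact: subset_closure.
  have U01 : U `<=` `]0, 1[ by exact: subset_trans O01.
  have H l : [/\ H1 U id, H1 U (v l) &
      (H1norm U (v l \- id)%R <= (2 * phase_error L (kap (e l)) (e l) C0)%:E)%E].
    have [locv vB _] := vP l.
    apply: (phase_H1norm (family_bounded (eL l)) (frequency_gt0 (eL l)) oU U01).
    - by move=> x /UO'; exact: locv.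
    - by move=> x /UO'; exact: vB.
  split; first by have [] := H 0%N.
    by apply: nearW => l; have [] := H l.
  apply: (@cvge0_squeeze _ _ _ _ (fun l => 2 * phase_error L (kap (e l)) (e l) C0)).
    by apply: nearW => l; rewrite H1norm_ge0; have [] := H l.
  rewrite -[X in _ --> X](mulr0 2); apply: cvgM; first exact: cvg_cst.
  apply: (@cvg_comp _ _ _ e (fun eps => phase_error L (kap eps) eps C0) _ _ _ cvge).
  exact: cvg_phase_error.
Qed.

End Family.

Unset Implicit Arguments.

(* The family (u eps) is indexed by a set Lam of positive parameters
   accumulating at 0; "eps -> 0" is the filter [within Lam (nbhs 0)]. *)
Theorem theorem5p2 (R : realType) (L alpha beta C0 : R) (Lam : set R)
    (u : R -> R -> R * R) :
  0 < L -> 0 <= alpha < 2 * pi -> 0 < beta < 1 / 2 ->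
  Lam `<=` [set eps | 0 < eps] -> closure Lam 0 ->
  (forall eps, Lam eps -> admissible alpha (u eps)) ->
  (forall eps, Lam eps -> (energy L beta eps (u eps) <= C0%:E)%E) ->
  [/\ cvg_L2 (within Lam (nbhs (0 : R))) `]0, 1[
        (fun eps x => modulus (u eps x) ^+ 2) (cst 1),
      (exists (J : set R) (eps_ : nat -> R) (v : nat -> R -> R),
        [/\ finite_set J /\ J `<=` `]0, 1[,
            [/\ forall l, Lam (eps_ l), decreasing_seq eps_ &
                eps_ l @[l --> \oo] --> 0],
            forall K : set R, compact K -> K `<=` `]0, 1[ `\` J ->
              exists2 eps0 : R, 0 < eps0 &
                forall l, eps_ l < eps0 ->
                  [/\ forall x, K x -> 0 < modulus (u (eps_ l) x),
                      {within K, continuous (v l)} &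
                      forall x, K x ->
                        u (eps_ l) x =
                        modulus (u (eps_ l) x) *:
                          expi (2 * pi * v l x / eps_ l `^ beta)] &
            cvg_H1loc \oo (`]0, 1[ `\` J) v id]) &
      weak_cvg_L2C (within Lam (nbhs (0 : R))) `]0, 1[ u (cst (0, 0))].
Proof.
move=> L0 _ /andP[b0 _] Lam0 cl0 adm enC; split.
- by apply: (@modulus_cvg_L2 _ L alpha beta C0).
- exact: (@family_subsequence _ L alpha beta C0).
- exact: (@family_weak_cvg _ L alpha beta C0).
Qed.
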